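(* Let $\mathcal C$ be a commutative wheelgebra admitting a dg wheelgebra of Kähler wheeldifferential forms $\Omega^\bullet_{\mathcal C}$, with differential $\mathsf D_{\mathcal C}\in\mathrm{Der}(\Omega^\bullet_{\mathcal C})$, and having wheelcontractions. Given $X,Y\in\mathrm{Der}(\mathcal C)$, with contractions $\mathsf i_X,\mathsf i_Y$ and Lie derivatives $\mathsf L_X,\mathsf L_Y$ on $\Omega^\bullet_{\mathcal C}$, one has $$\mathsf D_{\mathcal C}\circ\mathsf D_{\mathcal C}=0,\qquad \mathsf L_X=\mathsf D_{\mathcal C}\circ\mathsf i_X+\mathsf i_X\circ\mathsf D_{\mathcal C},\qquad[\mathsf D_{\mathcal C},\mathsf L_X]=0,$$ $$[\mathsf i_X,\mathsf i_Y]=0,\qquad[\mathsf L_X,\mathsf i_Y]=\mathsf i_{[X,Y]},\qquad[\mathsf L_X,\mathsf L_Y]=\mathsf L_{[X,Y]},$$ where the bracket in the left members is the graded commutator of homogeneous elements of $\mathrm{Hom}_{\text{wheelspaces}}(\Omega^\bullet_{\mathcal C},\Omega^\bullet_{\mathcal C})$ and the bracket in the right members is the usual commutator of derivations of $\mathcal C$.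
   Context: Conventions. $k$ is a field of characteristic $0$; vector spaces, algebras and $\otimes$ are over $k$. $\mathbb N_0=\{0,1,2,\dots\}$, $\mathbb N=\{1,2,\dots\}$. $\mathbb S_n$ is the group of permutations of $\{1,\dots,n\}$ (product = composition of maps). For $\sigma\in\mathbb S_n,\tau\in\mathbb S_m$, $\sigma\oplus\tau\in\mathbb S_{n+m}$ is the block sum ($\sigma$ on the first $n$ letters, $\tau$ on the last $m$), giving $\mathbb S_n\times\mathbb S_m\subseteq\mathbb S_{n+m}$; $\beta_{n,m}\in\mathbb S_{n+m}$ is $i\mapsto i+m$ for $i\le n$, $i\mapsto i-n$ for $i>n$. A diagonal $\mathbb S$-bimodule is a sequence $S=(S(n))_{n\in\mathbb N_0}$ of $k\mathbb S_n$-bimodules; morphisms are sequences of bimodule maps. Wheelspaces. For $\sigma\in\mathbb S_n$ and $1\le i\le n$, $r^n_i(\sigma)\in\mathbb S_{n-1}$ is obtained from $\sigma$ by deleting $i$ from the source and $\sigma(i)$ from the target and renumbering in the order-preserving way; $l^n_j(\sigma)=(r^n_j(\sigma^{-1}))^{-1}$. A wheelspace is a diagonal $\mathbb S$-bimodule $S$ with linear maps (contractions) ${}^n_jt_i\colon S(n)\to S(n-1)$, $n\in\mathbb N$, $1\le i,j\le n$, such that (W1) ${}^n_jt_i(\sigma v\tau)=l^n_j(\sigma)\cdot{}^{\ \ \ \ n}_{\sigma^{-1}(j)}t_{\tau(i)}(v)\cdot r^n_i(\tau)$ for $\sigma,\tau\in\mathbb S_n$; (W2) ${}^n_jt_i\circ{}^{n+1}_{\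 \ \ell}t_k={}^n_{j'}t_{i'}\circ{}^{n+1}_{\ \ \ell'}t_{k'}$, where $(i',k')=(k-1,i)$ if $i<k$ and $(k,i+1)$ if $k\le i$, and $(j',\ell')$ is obtained from $(j,\ell)$ by the same rule. Morphisms of wheelspaces are morphisms of diagonal $\mathbb S$-bimodules commuting with all contractions. Wheelgebras and wheelmodules. A wheelgebra is a wheelspace $\mathcal A$ with linear maps $\mu_{n,m}\colon\mathcal A(n)\otimes\mathcal A(m)\to\mathcal A(n+m)$ (written $ab$) that are morphisms of $k(\mathbb S_n\times\mathbb S_m)$-bimodules, associative, with a unit $1\in\mathcal A(0)$, and compatible with contractions: ${}^{n+m}_{\ \ \ j}t_i(ab)=({}^n_jt_i a)b$ if $i,j\le n$ and $=a({}^{\ \ m}_{j-n}t_{i-n}b)$ if $i,j>n$ ($a\in\mathcal A(n)$, $b\in\mathcal A(m)$). It is commutative if $ab=\beta_{m,n}\cdot(ba)\cdot\beta_{n,m}$. For a commutative wheelgebra $\mathcal C$, a $\mathcal C$-wheelmodule is a wheelspace $\mathcal N$ with an associative unital left action $\mathcal C(n)\otimes\mathcal N(m)\to\mathcal N(n+m)$, equivariant and compatible with contractions in the same sense; it is regarded as a symmetric bimodule with right action $xc=\beta_{m,n}\cdot(cx)\cdot\beta_{n,m}$ for $x\in\mathcal N(n)$, $c\in\mathcal C(m)$. Internal Hom and derivations. For a wheelspace $S'$ and $k\in\mathbb N_0$, $\mathrm{sh}_k(S')$ is the wheelspace with $\mathrm{sh}_k(S')(m)=S'(k+m)$, $\mathbb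 S_m$ acting on both sides through $\sigma\mapsto\mathrm{id}_k\oplus\sigma$, and contractions ${}^{k+m}_{j+k}t'_{i+k}$. $\mathcal H\mathrm{om}(S,S')$ is the wheelspace with $\mathcal H\mathrm{om}(S,S')(n)=\mathrm{Hom}_{\text{wheelspaces}}(S,\mathrm{sh}_n(S'))$, $\mathbb S_n$-actions $(\sigma' f\sigma)(v)=(\sigma'\oplus\mathrm{id})\cdot f(v)\cdot(\sigma\oplus\mathrm{id})$ and contractions $({}^n_jT_if)(m)={}^{n+m}_{\ \ \ j}t'_i\circ f(m)$. If $\mathcal N$ is a $\mathcal C$-wheelmodule, $\mathrm{sh}_k(\mathcal N)$ is a $\mathcal C$-wheelmodule whose right action is that of $\mathcal N$, $\mathcal N(k+n)\otimes\mathcal C(m)\to\mathcal N(k+n+m)$. $\mathrm{Der}(\mathcal C,\mathcal N)$ is the space of wheelspace morphisms $f\colon\mathcal C\to\mathcal N$ with $f(cc')=c\,f(c')+f(c)\,c'$. $\mathcal D\mathrm{er}(\mathcal C,\mathcal N)\subseteq\mathcal H\mathrm{om}(\mathcal C,\mathcal N)$ is the subwheelspace with $\mathcal D\mathrm{er}(\mathcal C,\mathcal N)(k)=\mathrm{Der}(\mathcal C,\mathrm{sh}_k\mathcal N)$, and $\mathcal H\mathrm{om}_{\mathcal C}(\mathcal M,\mathcal N)\subseteq\mathcal H\mathrm{om}(\mathcal M,\mathcal N)$ the one with $\mathcal H\mathrm{om}_{\mathcal C}(\mathcal M,\mathcal N)(k)=\mathrm{Hom}_{\mathcal C}(\mathcal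 M,\mathrm{sh}_k\mathcal N)$; both are $\mathcal C$-wheelmodules via $(c f)(x)=c\cdot f(x)$. Write $\mathcal D\mathrm{er}(\mathcal C)=\mathcal D\mathrm{er}(\mathcal C,\mathcal C)$ and $\mathrm{Der}(\mathcal C)=\mathcal D\mathrm{er}(\mathcal C)(0)$. Wheeldifferential forms. $\mathcal C$ admits a wheelmodule of Kähler wheeldifferential forms if there are a $\mathcal C$-wheelmodule $\Omega^1_{\mathsf{wh}}\mathcal C$ and isomorphisms $\mathcal D\mathrm{er}(\mathcal C,\mathcal N)\cong\mathcal H\mathrm{om}_{\mathcal C}(\Omega^1_{\mathsf{wh}}\mathcal C,\mathcal N)$ natural in the $\mathcal C$-wheelmodule $\mathcal N$; $\mathsf d_{\mathcal C}\in\mathrm{Der}(\mathcal C,\Omega^1_{\mathsf{wh}}\mathcal C)$ corresponds to the identity. Let $\mathsf G$ be the category of $\mathbb N_0$-graded wheelgebras $D=\bigoplus_dD_d$ that are graded commutative (commutative with the Koszul sign $(-1)^{|u||v|}$ inserted) with $D_0=\mathcal C$, with graded morphisms that are the identity on $\mathcal C$. $\mathcal C$ admits a graded wheelgebra of Kähler wheeldifferential forms if moreover there is $\Omega^\bullet_{\mathcal C}\in\mathsf G$ (the symmetric algebra of $\Omega^1_{\mathsf{wh}}\mathcal C$ placed in degree $1$) with a $\mathcal C$-wheelmodule morphism $\iota\colon\Omega^1_{\mathsf{wh}}\mathcal C\to\Omega^1_{\mathcal C}$ such that restriction along $\iota$ gives natural bijections $\mathrm{Hom}_{\mathsf G}(\Omega^\bullet_{\mathcal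 C},D)\cong\mathrm{Hom}_{\mathcal C}(\Omega^1_{\mathsf{wh}}\mathcal C,D_1)$ for $D\in\mathsf G$; then $\iota$ is an isomorphism and is used to identify $\Omega^1_{\mathcal C}=\Omega^1_{\mathsf{wh}}\mathcal C$. Derivations of $\Omega^\bullet_{\mathcal C}$ are taken in the graded sense (Koszul signs). $\mathcal C$ admits a dg wheelgebra of Kähler wheeldifferential forms if in addition there is a (necessarily unique) derivation $\mathsf D_{\mathcal C}\in\mathrm{Der}(\Omega^\bullet_{\mathcal C})$, homogeneous of degree $1$, with $\mathsf D_{\mathcal C}\circ\mathsf D_{\mathcal C}=0$ and $\mathsf D_{\mathcal C}|_{\mathcal C}=\iota\circ\mathsf d_{\mathcal C}$. Let $\mathcal D\mathrm{er}^{-1}(\Omega^\bullet_{\mathcal C})\subseteq\mathcal D\mathrm{er}(\Omega^\bullet_{\mathcal C})$ be the subwheelspace of elements homogeneous of degree $-1$; $\mathcal C$ has wheelcontractions if the restriction map $\mathcal D\mathrm{er}^{-1}(\Omega^\bullet_{\mathcal C})\to\mathcal H\mathrm{om}_{\mathcal C}(\Omega^1_{\mathsf{wh}}\mathcal C,\mathcal C)$, $d\mapsto d|_{\Omega^1_{\mathsf{wh}}\mathcal C}$, is an isomorphism. In that case $\mathrm{ext}\colon\mathcal D\mathrm{er}(\mathcal C)\to\mathcal D\mathrm{er}(\Omega^\bullet_{\mathcal C})$ is the composition $\mathcal D\mathrm{er}(\mathcal C)\cong\mathcal H\mathrm{om}_{\mathcal C}(\Omega^1_{\mathsf{wh}}\mathcal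 C,\mathcal C)\cong\mathcal D\mathrm{er}^{-1}(\Omega^\bullet_{\mathcal C})\subseteq\mathcal D\mathrm{er}(\Omega^\bullet_{\mathcal C})$. For $X\in\mathrm{Der}(\mathcal C)$: $\mathsf i_X=\mathrm{ext}(0)(X)\in\mathrm{Der}(\Omega^\bullet_{\mathcal C})$ is the contraction and $\mathsf L_X=\mathsf D_{\mathcal C}\circ\mathsf i_X+\mathsf i_X\circ\mathsf D_{\mathcal C}$ the Lie derivative. *)

(* Defs.v *)
From HB Require Import structures.
From mathcomp Require Import all_boot all_order all_algebra all_fingroup.
From mathcomp Require Import zify ssrAC.

Set Implicit Arguments.
Unset Strict Implicit.
Unset Printing Implicit Defensive.

Import Order.TTheory GRing.Theory Num.Theory.
Local Open Scope ring_scope.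

(* Conventions.
   - The letters 1..n are the elements 0..n-1 of 'I_n.
   - In mathcomp, (t * s)%g is the permutation i |-> s (t i); the composition
     of maps s o t used in the mathematics is therefore (t * s)%g.
   - S(n) -> S(n-1), n >= 1, is rendered as S n.+1 -> S n.
   - wcast e : S n -> S m is the identification of S(n) and S(m) when e : n = m.
   - Note that 0 + n is convertible to n and n.+1 + m to (n + m).+1.           *)

Section BlockSum.
Variables n m : nat.

Definition bsum_fun (s : 'S_n) (t : 'S_m) (i : 'I_(n + m)) : 'I_(n + m) :=
  match split i with
  | inl j => lshift m (s j)
  | inr j => rshift n (t j)
  end.

Lemma bsum_fun_inj s t : injective (bsum_fun s t).
Proof.
move=> i j; rewrite /bsum_fun.
case: (splitP i) => i' Ei; case: (splitP j) => j' Ej /(congr1 val) /=.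
- by move/val_inj/perm_inj => E; apply: val_inj; rewrite /= Ei Ej E.
- by move=> E; have := ltn_ord (s i'); rewrite E ltnNge leq_addr.
- by move=> E; have := ltn_ord (s j'); rewrite -E ltnNge leq_addr.
- move/eqP; rewrite eqn_add2l => /eqP/val_inj/perm_inj E.
  by apply: val_inj; rewrite /= Ei Ej E.
Qed.

Definition bsum (s : 'S_n) (t : 'S_m) : 'S_(n + m) := perm (@bsum_fun_inj s t).

Lemma bswap_fun_subproof (i : 'I_(n + m)) :
  ((if i < n then i + m else i - n) < n + m)%N.
Proof.
case: (ltnP i n) => [lt_in|le_ni]; first by rewrite ltn_add2r.
by rewrite (leq_ltn_trans (leq_subr _ _)).
Qed.

Definition bswap_fun (i : 'I_(n + m)) : 'I_(n + m) :=
  Ordinal (bswap_fun_subproof i).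

Lemma bswap_fun_inj : injective bswap_fun.
Proof.
move=> i j /(congr1 val) /= E; apply: val_inj => /=; move: E.
case: (ltnP i n) => Hi; case: (ltnP j n) => Hj.
- by move/eqP; rewrite eqn_add2r => /eqP.
- move=> E; have : (j - n < m)%N by rewrite ltn_subLR.
  by rewrite -E ltnNge leq_addl.
- move=> E; have : (i - n < m)%N by rewrite ltn_subLR.
  by rewrite E ltnNge leq_addl.
- by move=> E; rewrite -(subnK Hi) E subnK.
Qed.

Definition bswap : 'S_(n + m) := perm bswap_fun_inj.

End BlockSum.

Section Deletion.
Variable n : nat.

Definition del_fun (i : 'I_n.+1) (s : 'S_n.+1) (j : 'I_n) : 'I_n :=
  odflt j (unlift (s i) (s (lift i j))).

Lemma lift_del_fun (i : 'I_n.+1) (s : 'S_n.+1) (j : 'I_n) : lift (s i) (del_fun i s j) = s (lift i j).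
Proof.
rewrite /del_fun; case: unliftP => [h <- //|/perm_inj E].
by have := neq_lift i j; rewrite E eqxx.
Qed.

Lemma del_fun_inj (i : 'I_n.+1) (s : 'S_n.+1) : injective (del_fun i s).
Proof.
move=> j h E; apply: (@lift_inj _ i); apply: (@perm_inj _ s).
by rewrite -!lift_del_fun E.
Qed.

(* r^{n+1}_i (s) and l^{n+1}_j (s) *)
Definition del_src (i : 'I_n.+1) (s : 'S_n.+1) : 'S_n := perm (@del_fun_inj i s).
Definition del_tgt (j : 'I_n.+1) (s : 'S_n.+1) : 'S_n :=
  ((del_src j s^-1)^-1)%g.

End Deletion.

(* Contracting k and then i amounts to contracting k' and then i', where
   (i', k') = swap_idx i k; all the values given to inord are in range. *)
Definition swap_idx n (i : 'I_n.+1) (k : 'I_n.+2) : 'I_n.+1 * 'I_n.+2 :=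
  if (i < k)%N then (inord k.-1, inord i) else (inord k, inord i.+1).

Local Open Scope nat_scope.

(* s extended to nat by the identity; equalities of permutations are proved
   pointwise on nat, which gets rid of the casts. *)
Definition pv n (s : 'S_n) (k : nat) : nat :=
  if insub k is Some i then val (s i) else k.
Lemma pvE n (s : 'S_n) (i : 'I_n) : pv s i = s i.
Proof. by rewrite /pv valK. Qed.
Lemma pv_out n (s : 'S_n) k : n <= k -> pv s k = k.
Proof. by move=> h; rewrite /pv insubF // ltnNge h. Qed.
Lemma pv_lt n (s : 'S_n) k : (pv s k < n) = (k < n).
Proof.
case: (ltnP k n) => h; last by rewrite pv_out // ltnNge h.
by rewrite -[k]/(val (Ordinal h)) pvE ltn_ord.
Qed.
Lemma pv_inj n (s t : 'S_n) : pv s =1 pv t -> s = t.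
Proof. by move=> h; apply/permP => i; apply: val_inj; have := h i; rewrite !pvE. Qed.
Lemma pv1 n k : pv (1%g : 'S_n) k = k.
Proof. by rewrite /pv; case: insubP => // i _ <-; rewrite perm1. Qed.
Lemma pvM n (s t : 'S_n) k : pv (t * s)%g k = pv s (pv t k).
Proof.
case: (ltnP k n) => h; last by rewrite !pv_out // pv_out.
by rewrite -[k]/(val (Ordinal h)) !pvE permM.
Qed.
Lemma pv_cast n m (e : n = m) (s : 'S_n) : pv (cast_perm e s) =1 pv s.
Proof. by case: m / e; rewrite cast_perm_id. Qed.
Lemma pv_bsum n m (s : 'S_n) (t : 'S_m) k :
  pv (bsum s t) k = if k < n then pv s k else n + pv t (k - n).
Proof.
case: (ltnP k (n + m)) => h; last first.
  rewrite (pv_out _ h); case: ltnP => h'; first lia.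
  by rewrite pv_out; lia.
rewrite -[k in LHS]/(val (Ordinal h)) pvE permE /bsum_fun.
case: splitP => j /= E; first by rewrite E ltn_ord pvE.
by rewrite E ltnNge leq_addr /= addKn pvE.
Qed.
Lemma pv_bswap n m k :
  pv (bswap n m) k = if k < n then k + m else if k < n + m then k - n else k.
Proof.
case: (ltnP k (n + m)) => h; last by rewrite pv_out //; case: ifP; lia.
by rewrite -[k in LHS]/(val (Ordinal h)) pvE permE.
Qed.
Lemma pvKV n (s : 'S_n) k : pv s (pv s^-1 k)%g = k.
Proof. by rewrite -pvM mulVg pv1. Qed.
Lemma pvVK n (s : 'S_n) k : pv s^-1%g (pv s k) = k.
Proof. by rewrite -pvM mulgV pv1. Qed.
Lemma pv_del n (i : 'I_n.+1) (s : 'S_n.+1) k : k < n ->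
  bump (pv s i) (pv (del_src i s) k) = pv s (bump i k).
Proof.
move=> h; rewrite -[k]/(val (Ordinal h)) !pvE permE.
by rewrite -[bump i _]/(val (lift i (Ordinal h))) pvE -lift_del_fun.
Qed.

Ltac pvs := rewrite ?(pvM, pv_cast, pv_bsum, pv_bswap, pv1).

Lemma bsum1M p n (s t : 'S_n) :
  bsum (1%g : 'S_p) (t * s)%g = (bsum 1 t * bsum 1 s)%g.
Proof.
apply: pv_inj => k; pvs; case: (ltnP k p) => h; first by rewrite ?h ?pv1 ?h.
by rewrite ltnNge leq_addr /= addKn.
Qed.
Lemma bsum11 p n : bsum (1%g : 'S_p) (1%g : 'S_n) = 1%g.
Proof. by apply: pv_inj => k; pvs; case: ltnP => h //; lia. Qed.
Lemma bsum1V p n (s : 'S_n) : bsum (1%g : 'S_p) (s^-1)%g = (bsum 1 s)^-1%g.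
Proof. by apply/esym/eqP; rewrite eq_invg_mul -bsum1M mulgV bsum11. Qed.
Lemma del_bsum1 p n (i : 'I_n.+1) (s : 'S_n.+1) :
  del_src (cast_ord (addnS p n) (rshift p i)) (cast_perm (addnS p n) (bsum 1 s))
  = bsum 1 (del_src i s).
Proof.
set J := cast_ord _ _; set t := cast_perm _ _.
apply: pv_inj => k; case: (ltnP k (p + n)) => h; last by rewrite !pv_out.
have E := pv_del J t h.
pvs; have : pv t J = (p + pv s i)%N.
  by rewrite /t /J; pvs; rewrite /= ltnNge leq_addr /= addKn.
move=> Ej; apply: (can_inj (bumpK (p + pv s i)%N)); rewrite -{1}Ej E /t /J /=; pvs.
case: (ltnP k p) => hk.
  have -> : bump (p + i) k = k by rewrite /bump; lia.
  by rewrite hk /bump; lia.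
have h' : (k - p < n)%N by lia.
have := pv_del i s h' => E'.
have -> : bump (p + i) k = (p + bump i (k - p))%N by rewrite /bump; lia.
rewrite ltnNge leq_addr /= addKn -E' /bump; lia.
Qed.

Lemma swap_idx_shift p n (i : 'I_n.+1) (k : 'I_n.+2) :
  let c1 q (x : 'I_q.+1) := cast_ord (addnS p q) (rshift p x) in
  let c2 := fun x : 'I_n.+2 => cast_ord (congr1 S (addnS p n)) (c1 _ x) in
  swap_idx (c1 _ i) (c2 k) = (c1 _ (swap_idx i k).1, c2 (swap_idx i k).2).
Proof.
move=> /=; have := ltn_ord i; have := ltn_ord k => hk hi.
rewrite /swap_idx /= ltn_add2l; case: ifP => h; congr (_, _); apply: val_inj;
  rewrite /= !inordK /=; lia.
Qed.

Lemma pv_delE n (i : 'I_n.+1) (s : 'S_n.+1) (t : 'S_n) :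
  (forall k, (k < n)%N -> bump (pv s i) (pv t k) = pv s (bump i k)) -> del_src i s = t.
Proof.
move=> H; apply: pv_inj => k; case: (ltnP k n) => h; last by rewrite !pv_out.
by apply: (can_inj (bumpK (pv s i))); rewrite pv_del // H.
Qed.

Lemma del_tgtE n (J0 : 'I_n.+1) (b : 'S_n.+1) : del_tgt (b J0) b = del_src J0 b.
Proof.
apply/invg_inj; rewrite /del_tgt invgK; apply: pv_delE => k hk.
set d := del_src J0 b.
have hk' : (pv d^-1%g k < n)%N by rewrite pv_lt.
have := pv_del J0 b hk'; rewrite -/d pvKV pvE => ->.
by rewrite pvVK -[nat_of_ord (b J0)]pvE pvVK.
Qed.
Lemma pv_delP n (i : 'I_n.+1) (s : 'S_n.+1) m (t : 'S_m) :
  n = m -> (forall k, (k < n)%N -> bump (pv s i) (pv t k) = pv s (bump i k)) -> pv (del_src i s) =1 pv t.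
Proof. by move=> E; case: m / E t => t H k; rewrite (pv_delE H). Qed.

Ltac ifs1 := match goal with |- context [if (?a < ?b)%N then _ else _] =>
   first [ have -> /= : (a < b)%N = true by lia
         | have -> /= : (a < b)%N = false by lia ] end.
Ltac unipv := repeat match goal with |- context [pv ?s ?a] =>
  match goal with |- context [pv s ?b] => assert_fails (constr_eq a b); have -> : b = a by lia end end.
Ltac fin := repeat (ifs1; pvs); first [reflexivity | lia | unipv; try lia].

Lemma bsum0 n (s : 'S_n) : bsum (1%g : 'S_0) s = s.
Proof. by apply: pv_inj => k; rewrite pv_bsum subn0. Qed.

Local Open Scope ring_scope.

Section Wheelspaces.
Variable K : fieldType.

Record wheelData := WheelData {
  car :> nat -> lmodType K;
  permL : forall n, 'S_n -> car n -> car n;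
  permR : forall n, 'S_n -> car n -> car n;
  (* contr j i is the contraction with lower left index j, lower right i *)
  contr : forall n, 'I_n.+1 -> 'I_n.+1 -> car n.+1 -> car n }.

Definition wcast (S : wheelData) n m (e : n = m) (v : S n) : S m :=
  ecast i (S i) e v.

Record is_wheelspace (S : wheelData) : Prop := IsWheelspace {
  permL_linear : forall n (s : 'S_n), linear (@permL S n s);
  permR_linear : forall n (s : 'S_n), linear (@permR S n s);
  permL1 : forall n (v : S n), permL 1%g v = v;
  permR1 : forall n (v : S n), permR 1%g v = v;
  permLM : forall n (s t : 'S_n) (v : S n),
    permL (t * s)%g v = permL s (permL t v);
  permRM : forall n (s t : 'S_n) (v : S n),
    permR (t * s)%g v = permR t (permR s v);
  permLR : forall n (s t : 'S_n) (v : S n),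
    permL s (permR t v) = permR t (permL s v);
  contr_linear : forall n (j i : 'I_n.+1), linear (@contr S n j i);
  contr_perm : forall n (s t : 'S_n.+1) (j i : 'I_n.+1) (v : S n.+1),
    contr j i (permL s (permR t v)) =
    permL (del_tgt j s) (permR (del_src i t) (contr ((s^-1)%g j) (t i) v));
  contr_contr : forall n (j i : 'I_n.+1) (l k : 'I_n.+2) (v : S n.+2),
    contr j i (contr l k v) =
    contr (swap_idx j l).1 (swap_idx i k).1
      (contr (swap_idx j l).2 (swap_idx i k).2 v) }.

Record wheelspace := Wheelspace {
  ws_data :> wheelData;
  wsP : is_wheelspace ws_data }.

Record is_wmor (S T : wheelData) (f : forall n, S n -> T n) : Prop := IsWmor {
  wmor_linear : forall n, linear (f n);
  wmor_permL : forall n (s : 'S_n) v, f n (permL s v) = permL s (f n v);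
  wmor_permR : forall n (s : 'S_n) v, f n (permR s v) = permR s (f n v);
  wmor_contr : forall n (j i : 'I_n.+1) v,
    f n (contr j i v) = contr j i (f n.+1 v) }.

Definition sh (p : nat) (S : wheelData) : wheelData := {|
  car := fun m => S (p + m)%N;
  permL := fun m s => @permL S (p + m)%N (bsum 1%g s);
  permR := fun m s => @permR S (p + m)%N (bsum 1%g s);
  contr := fun m j i v =>
    @contr S (p + m)%N (cast_ord (addnS p m) (rshift p j))
      (cast_ord (addnS p m) (rshift p i)) (wcast (addnS p m) v) |}.

Implicit Type S : wheelData.
Lemma wcast_permL S n m (e : n = m) (s : 'S_n) (v : S n) :
  wcast e (permL s v) = permL (cast_perm e s) (wcast e v).
Proof. by case: m / e; rewrite cast_perm_id. Qed.
Lemma wcast_permR S n m (e : n = m) (s : 'S_n) (v : S n) :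
  wcast e (permR s v) = permR (cast_perm e s) (wcast e v).
Proof. by case: m / e; rewrite cast_perm_id. Qed.
Lemma wcast_trans S n m p (e : n = m) (e' : m = p) (v : S n) :
  wcast e' (wcast e v) = wcast (etrans e e') v.
Proof. by case: p / e'; case: m / e. Qed.
Lemma wcast_id S n (e : n = n) (v : S n) : wcast e v = v.
Proof. by rewrite (eq_irrelevance e erefl). Qed.
Lemma wcast_irr S n m (e e' : n = m) (v : S n) : wcast e v = wcast e' v.
Proof. by rewrite (eq_irrelevance e e'). Qed.
Lemma wcast_sh S p n m (e : n = m) (v : sh p S n) :
  wcast e v = wcast (S := S) (congr1 (addn p) e) v.
Proof. by case: m / e. Qed.
Lemma wcast_contr S n m (e : n.+1 = m.+1) (e' : n = m) (j i : 'I_n.+1) (v : S n.+1) :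
  contr (cast_ord e j) (cast_ord e i) (wcast e v) = wcast e' (contr j i v).
Proof. by case: m / e' e => e; rewrite !cast_ord_id !wcast_id. Qed.

Lemma permRL_congr S n m (a b : 'S_n) (c d : 'S_n) (e e' : m = n) (v : S m) :
   pv a =1 pv c -> pv b =1 pv d ->
   permR a (permL b (wcast e v)) = permR c (permL d (wcast e' v)).
Proof. by move=> /pv_inj -> /pv_inj ->; rewrite (wcast_irr e e'). Qed.

Lemma wcast_linear (S : wheelData) n m (e : n = m) : linear (@wcast S n m e).
Proof. by case: m / e. Qed.

Lemma contr_perm2 (S : wheelData) (hS : is_wheelspace S) n (J I J0 I0 : 'I_n.+1) (a b : 'S_n.+1) (z : S n.+1) :
  b J0 = J -> a I = I0 ->
  contr J I (permR a (permL b z)) = permR (del_src I a) (permL (del_src J0 b) (contr J0 I0 z)).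
Proof.
move=> <- <-; rewrite -(permLR hS) (contr_perm hS) permK del_tgtE.
by rewrite (permLR hS).
Qed.
Lemma sh_is_wheelspace p (S : wheelData) :
  is_wheelspace S -> is_wheelspace (sh p S).
Proof.
move=> h; split=> /=.
- by move=> n s; exact: (permL_linear h).
- by move=> n s; exact: (permR_linear h).
- by move=> n v; rewrite bsum11 (permL1 h).
- by move=> n v; rewrite bsum11 (permR1 h).
- by move=> n s t v; rewrite bsum1M (permLM h).
- by move=> n s t v; rewrite bsum1M (permRM h).
- by move=> n s t v; exact: (permLR h).
- move=> n j i a u v; rewrite -(contr_linear h); congr contr.
  by move: u v; case: _ / (addnS p n).
- move=> n s t j i v; rewrite wcast_permL wcast_permR (contr_perm h).
  have EV : (cast_perm (addnS p n) (bsum 1 s))^-1%g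
          = cast_perm (addnS p n) (bsum 1 s^-1).
    apply/eqP; rewrite eq_invg_mul; apply/eqP; apply: pv_inj => k.
    by rewrite pvM !pv_cast pv1 bsum1V pvVK.
  have EI (u : 'S_n.+1) (x : 'I_n.+1) :
     cast_perm (addnS p n) (bsum 1 u) (cast_ord (addnS p n) (rshift p x))
     = cast_ord (addnS p n) (rshift p (u x)).
    apply: val_inj; rewrite /= -pvE pv_cast pv_bsum /= ltnNge leq_addr /= addKn.
    by rewrite pvE.
  by rewrite !del_bsum1 /del_tgt EV !del_bsum1 !EI bsum1V.
- move=> n j i l k v.
  have E2 := addnS p n.+1.
  set e1 := addnS p n.
  have E (q : 'I_n.+1) (q' : 'I_n.+1) (x x' : 'I_n.+2) :
    contr (cast_ord e1 (rshift p q)) (cast_ord e1 (rshift p q'))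
      (wcast e1 (contr (cast_ord (addnS p n.+1) (rshift p x))
           (cast_ord (addnS p n.+1) (rshift p x')) (wcast (addnS p n.+1) v)))
    = contr (cast_ord e1 (rshift p q)) (cast_ord e1 (rshift p q'))
       (contr (cast_ord (congr1 succn e1) (cast_ord (addnS p n.+1) (rshift p x)))
              (cast_ord (congr1 succn e1) (cast_ord (addnS p n.+1) (rshift p x')))
          (wcast (congr1 succn e1) (wcast (addnS p n.+1) v))).
    by rewrite (wcast_contr _ e1).
  rewrite !E (contr_contr h).
  have := swap_idx_shift p j l; have := swap_idx_shift p i k => /= Ei Ej.
  by rewrite Ei Ej.
Qed.

(* Hom(S,T)(p) consists of the f : fam S T p such that is_wmor f; the
   operations on internal Hom are defined on all of fam. *)
Definition fam (S T : wheelData) (p : nat) := forall n, S n -> sh p T n.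

Definition eqfam (S T : wheelData) p (f g : fam S T p) : Prop :=
  forall n (x : S n), f n x = g n x.

Definition fam_lin (S T : wheelData) p (a : K) (f g : fam S T p) : fam S T p :=
  fun n x => a *: f n x + g n x.

Definition fam_permL (S T : wheelData) p (s : 'S_p) (f : fam S T p) :
  fam S T p := fun n x => @permL T (p + n)%N (bsum s 1%g) (f n x).

Definition fam_permR (S T : wheelData) p (s : 'S_p) (f : fam S T p) :
  fam S T p := fun n x => @permR T (p + n)%N (bsum s 1%g) (f n x).

Definition fam_contr (S T : wheelData) p (j i : 'I_p.+1) (f : fam S T p.+1) :
  fam S T p := fun n x => @contr T (p + n)%N (lshift n j) (lshift n i) (f n x).

Record is_wheelgebra (S : wheelData)
    (wmul : forall n m, S n -> S m -> S (n + m)%N) (wone : S 0) : Prop :=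
  IsWheelgebra {
  wmul_linearl : forall n m (b : S m), linear (fun a : S n => wmul n m a b);
  wmul_linearr : forall n m (a : S n), linear (fun b : S m => wmul n m a b);
  wmul_permL : forall n m (s : 'S_n) (t : 'S_m) a b,
    wmul n m (permL s a) (permL t b) = permL (bsum s t) (wmul n m a b);
  wmul_permR : forall n m (s : 'S_n) (t : 'S_m) a b,
    wmul n m (permR s a) (permR t b) = permR (bsum s t) (wmul n m a b);
  wmulA : forall n m p (a : S n) (b : S m) (c : S p),
    wmul _ _ (wmul _ _ a b) c = wcast (addnA n m p) (wmul _ _ a (wmul _ _ b c));
  wmul1l : forall n (a : S n), wmul 0 n wone a = a;
  wmul1r : forall n (a : S n), wcast (addn0 n) (wmul n 0 a wone) = a;
  wmul_contrl : forall n m (j i : 'I_n.+1) (a : S n.+1) (b : S m),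
    @contr S (n + m)%N (lshift m j) (lshift m i) (wmul n.+1 m a b) =
    wmul n m (contr j i a) b;
  wmul_contrr : forall n m (j i : 'I_m.+1) (a : S n) (b : S m.+1),
    @contr S (n + m)%N (cast_ord (addnS n m) (rshift n j))
      (cast_ord (addnS n m) (rshift n i)) (wcast (addnS n m) (wmul n m.+1 a b)) =
    wmul n m a (contr j i b) }.

Record wheelgebra := Wheelgebra {
  wg_space :> wheelspace;
  wmul : forall n m, wg_space n -> wg_space m -> wg_space (n + m)%N;
  wone : wg_space 0;
  wgP : is_wheelgebra wmul wone }.

(* beta_{m,n} . v . beta_{n,m}, for v in S(m+n); the result is in S(n+m) *)
Definition block_flip (S : wheelData) m n (v : S (m + n)%N) : S (n + m)%N :=
  permR (bswap n m) (wcast (addnC m n) (permL (bswap m n) v)).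

Definition wheel_commutative (A : wheelgebra) : Prop :=
  forall n m (a : A n) (b : A m), wmul a b = block_flip (wmul b a).

Record comWheelgebra := ComWheelgebra {
  cwg :> wheelgebra;
  cwgP : wheel_commutative cwg }.

Record is_wgmor (A B : wheelgebra) (f : forall n, A n -> B n) : Prop :=
  IsWgmor {
  wgmor_wmor : is_wmor f;
  wgmor_mul : forall n m (a : A n) (b : A m),
    f _ (wmul a b) = wmul (f n a) (f m b);
  wgmor_one : f 0%N (wone A) = wone B }.

Record wmodData (A : wheelgebra) := WmodData {
  wm_data :> wheelData;
  wact : forall n m, A n -> wm_data m -> wm_data (n + m)%N }.

Record is_wheelmodule (A : wheelgebra) (N : wmodData A) : Prop :=
  IsWheelmodule {
  wmod_wheelspace : is_wheelspace N;
  wact_linearl : forall n m (x : N m), linear (fun c : A n => wact c x);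
  wact_linearr : forall n m (c : A n), linear (fun x : N m => wact c x);
  wact_permL : forall n m (s : 'S_n) (t : 'S_m) (c : A n) (x : N m),
    wact (permL s c) (permL t x) = permL (bsum s t) (wact c x);
  wact_permR : forall n m (s : 'S_n) (t : 'S_m) (c : A n) (x : N m),
    wact (permR s c) (permR t x) = permR (bsum s t) (wact c x);
  wactA : forall n m p (c : A n) (d : A m) (x : N p),
    wact (wmul c d) x = wcast (addnA n m p) (wact c (wact d x));
  wact1l : forall n (x : N n), wact (wone A) x = x;
  wact_contrl : forall n m (j i : 'I_n.+1) (c : A n.+1) (x : N m),
    @contr N (n + m)%N (lshift m j) (lshift m i) (wact c x) =
    wact (contr j i c) x;
  wact_contrr : forall n m (j i : 'I_m.+1) (c : A n) (x : N m.+1),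
    @contr N (n + m)%N (cast_ord (addnS n m) (rshift n j))
      (cast_ord (addnS n m) (rshift n i)) (wcast (addnS n m) (wact c x)) =
    wact c (contr j i x) }.

Record wheelmodule (C : comWheelgebra) := Wheelmodule {
  wmod_data :> wmodData C;
  wmodP : is_wheelmodule wmod_data }.

Definition wreg_data (A : wheelgebra) : wmodData A :=
  @WmodData A A (@wmul A).

Lemma wreg_is_wheelmodule (A : wheelgebra) : is_wheelmodule (wreg_data A).
Proof.
have [h1 h2 h3 h4 h5 h6 h7 h8 h9] := wgP A.
by split=> //; exact: wsP.
Qed.

Definition wreg (C : comWheelgebra) : wheelmodule C :=
  Wheelmodule (wreg_is_wheelmodule C).

(* The right action of the symmetric bimodule structure. *)
Definition wrmul (A : wheelgebra) (N : wmodData A) n m (x : N n) (c : A m) :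
  N (n + m)%N := block_flip (wact c x).

(* sh_p N.  Its left action is (beta_{n,p} (+) id) . (c x) . (beta_{p,n} (+) id):
   the block of letters of c is moved past the p distinguished letters of x.
   This is the left action for which the right action of the symmetric bimodule
   sh_p N is the right action N(p+n) (x) A(m) -> N(p+n+m) of N, see
   wrmul_sh_mod below.  In the graded setting the two Koszul signs between
   left and right actions cancel, so that the formula is the same. *)
Definition sh_act (A : wheelgebra) (N : wmodData A) p n m
    (c : A n) (x : N (p + m)%N) : N (p + (n + m))%N :=
  wcast (esym (addnA p n m))
    (permR (bsum (bswap p n) 1%g)
      (wcast (congr1 (addn^~ m) (addnC n p))
        (permL (bsum (bswap n p) 1%g) (wcast (addnA n p m) (wact c x))))).

Definition sh_mod (A : wheelgebra) (p : nat) (N : wmodData A) : wmodData A :=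
  @WmodData A (sh p N) (fun n m => @sh_act A N p n m).

Lemma wrmul_sh_mod (A : wheelgebra) (N : wmodData A) p n m
    (x : N (p + n)%N) (c : A m) : is_wheelspace N ->
  wrmul (N := sh_mod p N) (x : sh p N n) c =
  wcast (esym (addnA p n m)) (wrmul (x : N (p + n)%N) c).
Proof.
move=> hN; rewrite /wrmul /block_flip /= /sh_act /=.
rewrite wcast_sh.
rewrite !(wcast_permL, wcast_permR, permLR hN) -!(permRM hN) -!(permLM hN) !wcast_trans.
apply: permRL_congr => k; pvs.
  repeat case: ifP; lia.
  repeat case: ifP; lia.
Qed.

Section ShiftModule.
Variables (A : wheelgebra) (N : wmodData A) (hM : is_wheelmodule N) (p : nat).
Let h := wmod_wheelspace hM.

Lemma wact_cast n m m' (e : m = m') (c : A n) (x : N m) :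
  wact c (wcast e x) = wcast (congr1 (addn n) e) (wact c x).
Proof. by case: m' / e. Qed.
Lemma wactR n m (b : 'S_m) (c : A n) (x : N m) :
  wact c (permR b x) = permR (bsum 1 b) (wact c x).
Proof. by rewrite -(wact_permR hM) (permR1 (wsP _)). Qed.
Lemma wactL n m (b : 'S_m) (c : A n) (x : N m) :
  wact c (permL b x) = permL (bsum 1 b) (wact c x).
Proof. by rewrite -(wact_permL hM) (permL1 (wsP _)). Qed.
Definition permRL_nf := (@wcast_sh, @wcast_permL, @wcast_permR, permLR h, wcast_trans).

Lemma sh_mod_is_wheelmodule : is_wheelmodule (sh_mod p N).
Proof.
split.
- exact: sh_is_wheelspace.
- move=> n m x a u v /=; rewrite /sh_act (wact_linearl hM).
  by rewrite !(wcast_linear, permL_linear h, permR_linear h).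
- move=> n m c a u v /=; rewrite /sh_act (wact_linearr hM).
  by rewrite !(wcast_linear, permL_linear h, permR_linear h).
- move=> n m s t c x /=; rewrite /sh_act (wact_permL hM).
  rewrite !permRL_nf -?(permLM h) -?(permRM h).
  apply: permRL_congr => k //; pvs.
  have A1 := pv_lt s k; have A2 := pv_lt t (k - (n + p)).
  case: (ltnP k n) => ?; [|case: (ltnP k (n+p)%N) => ?].
  - fin.
  - fin.
  - fin.
- move=> n m s t c x /=; rewrite /sh_act (wact_permR hM).
  rewrite !permRL_nf -?(permLM h) -?(permRM h).
  apply: permRL_congr => k //; pvs.
  have A1 := pv_lt s (k - p); have A2 := pv_lt t (k - (n + p)).
  case: (ltnP k p) => ?; [|case: (ltnP k (n+p)%N) => ?].
  - fin.
  - fin.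
  - fin.
- move=> n m q c d x /=; rewrite /sh_act (wactA hM).
  rewrite ?(wact_cast, wactR, wactL) !permRL_nf -?(permLM h) -?(permRM h).
  apply: permRL_congr => k; pvs.
  - by case: (ltnP k p) => ?; [|case: (ltnP k (p+n)%N) => ?; [|case: (ltnP k (p+n+m)%N) => ?]]; fin.
  - by case: (ltnP k n) => ?; [|case: (ltnP k (n+m)%N) => ?; [|case: (ltnP k (n+m+p)%N) => ?]]; fin.
- move=> n x /=; rewrite /sh_act (wact1l hM) !permRL_nf.
  transitivity (permR (1%g : 'S_(p + n)) (permL (1%g : 'S_(p + n)) (wcast (erefl (p + n)%N) x))); last first.
    by rewrite (permL1 h) (permR1 h).
  apply: permRL_congr => k; pvs; repeat (case: ltnP => ?); lia.
- move=> n m j i c x /=; rewrite /sh_act.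
  rewrite -(wact_contrl hM) !permRL_nf.
  set a := cast_perm _ _; set b := cast_perm _ _; set e1 := etrans _ _.
  set y := @wact A N n.+1 (p + m)%N c x.
  have [e2 E2] : exists e2 : (n + (p + m)).+1 = (p + (n + m)).+1,
     @wcast N _ _ e1 y = @wcast N _ _ e2 y by exists e1.
  rewrite E2.
  rewrite (@contr_perm2 N h _ _ _ (cast_ord e2 (lshift (p + m) j)) (cast_ord e2 (lshift (p + m) i))).
  + have e3 : (n + (p + m) = p + (n + m))%N by lia.
    rewrite (wcast_contr e2 e3).
    apply: permRL_congr.
    * apply: pv_delP => // k hk; rewrite /a; have hi := ltn_ord i; pvs => /=; rewrite /bump.
      case: (ltnP k p) => ?; [|case: (ltnP k (p+n)%N) => ?]; case: (leqP i k) => ?; case: (leqP (p + i) k) => ?; by fin.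
    * apply: pv_delP => // k hk; rewrite /b; have hi := ltn_ord j; pvs => /=; rewrite /bump.
      by case: (ltnP k n) => ?; [|case: (ltnP k (p+n)%N) => ?]; case: (leqP j k) => ?; fin.
  + apply: val_inj; rewrite /= -pvE /b; have := ltn_ord j; pvs => /= hj; fin.
  + apply: val_inj; rewrite /= -pvE /a; have := ltn_ord i; pvs => /= hj; fin.
- move=> n m j i c x /=; rewrite /sh_act -(wact_contrr hM) wact_cast !permRL_nf.
  set a := cast_perm _ _; set b := cast_perm _ _.
  set y := @wact A N n (p + m.+1)%N c x.
  set e1 := etrans _ _; set e0 := etrans (congr1 _ _) _.
  set J0 := cast_ord (addnS n (p + m)) (rshift n (cast_ord (addnS p m) (rshift p j))).
  set I0 := cast_ord (addnS n (p + m)) (rshift n (cast_ord (addnS p m) (rshift p i))).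
  have e2 : (n + (p + m)).+1 = (p + (n + m)).+1 by lia.
  have -> : @wcast N _ _ e1 y = @wcast N _ _ e2 (wcast e0 y).
    by rewrite wcast_trans; apply: wcast_irr.
  rewrite (@contr_perm2 N h _ _ _ (cast_ord e2 J0) (cast_ord e2 I0)).
  + have e3 : (n + (p + m) = p + (n + m))%N by lia.
    rewrite (wcast_contr e2 e3).
    apply: permRL_congr.
    * apply: pv_delP => // k hk; rewrite /a; have hi := ltn_ord i; pvs => /=; rewrite /bump.
      by case: (ltnP k p) => ?; [|case: (ltnP k (p+n)%N) => ?]; case: (leqP (p + (n + i)) k) => ?; fin.
    * apply: pv_delP => // k hk; rewrite /b; have hi := ltn_ord j; pvs => /=; rewrite /bump.
      by case: (ltnP k n) => ?; [|case: (ltnP k (p+n)%N) => ?]; case: (leqP (n + (p + j)) k) => ?; fin.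
  + apply: val_inj; rewrite /= -pvE /b; have := ltn_ord j; pvs => /= hj; fin.
  + apply: val_inj; rewrite /= -pvE /a; have := ltn_ord i; pvs => /= hj; fin.
Qed.
End ShiftModule.

Lemma sh0_contr (S : wheelData) n (j i : 'I_n.+1) (v : S n.+1) :
  @contr (sh 0 S) n j i v = contr j i v.
Proof.
rewrite /= wcast_id; congr (@contr S n _ _ v); exact: val_inj.
Qed.

Lemma sh0_wmor (S T : wheelData) (f : forall n, S n -> T n) :
  is_wmor (T := sh 0 T) f <-> is_wmor f.
Proof.
split=> -[h1 h2 h3 h4]; split=> //.
- by move=> n s v; rewrite h2 /= bsum0.
- by move=> n s v; rewrite h3 /= bsum0.
- by move=> n j i v; rewrite h4 sh0_contr.
- by move=> n s v; rewrite h2 /= bsum0.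
- by move=> n s v; rewrite h3 /= bsum0.
- by move=> n j i v; rewrite h4 sh0_contr.
Qed.

Lemma sh0_act (A : wheelgebra) (N : wmodData A) n m (c : A n) (x : N m) :
  is_wheelmodule N -> sh_act (p := 0) c x = wact c x.
Proof.
move=> hN; have h := wmod_wheelspace hN; rewrite /sh_act.
rewrite !(permRL_nf hN).
transitivity (permR (1%g : 'S_(n + m)) (permL (1%g : 'S_(n + m)) (wcast (erefl (n + m)%N) (wact c x)))); last by rewrite (permL1 h) (permR1 h).
by apply: permRL_congr => k; pvs; repeat (case: ltnP => ?); lia.
Qed.

Record is_wmodmor (A : wheelgebra) (M N : wmodData A)
    (f : forall n, M n -> N n) : Prop := IsWmodmor {
  wmodmor_wmor : is_wmor f;
  wmodmor_act : forall n m (c : A n) (x : M m), f _ (wact c x) = wact c (f m x) }.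

Record is_der (A : wheelgebra) (N : wmodData A)
    (f : forall n, A n -> N n) : Prop := IsDer {
  der_wmor : is_wmor f;
  der_mul : forall n m (c : A n) (d : A m),
    f _ (wmul c d) = wact c (f m d) + wrmul (f n c) d }.

(* Membership in the components of arity p of the internal Der(C,N) and
   Hom_C(M,N); for N = C and p = 0 this is Der(C), cf. iDer0. *)
Definition iDer (C : comWheelgebra) (N : wheelmodule C) p (f : fam C N p) :
  Prop := is_der (N := sh_mod p N) f.

Definition iHom (C : comWheelgebra) (M N : wheelmodule C) p
  (f : fam M N p) : Prop := is_wmodmor (N := sh_mod p N) f.

Lemma iHom0 (C : comWheelgebra) (M N : wheelmodule C) (f : forall n, M n -> N n) :
  iHom (p := 0) f <-> is_wmodmor f.
Proof.
have hN := wmodP N.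
split=> -[h1 h2].
  split; first exact: (proj1 (sh0_wmor _) h1).
  by move=> n m c x; rewrite h2 /= sh0_act.
split; first exact: (proj2 (sh0_wmor _) h1).
by move=> n m c x; rewrite h2 /= sh0_act.
Qed.

Lemma iDer0 (C : comWheelgebra) (N : wheelmodule C) (f : forall n, C n -> N n) :
  iDer (p := 0) f <-> is_der f.
Proof.
have hN := wmodP N; have h := wmod_wheelspace hN.
have E n m c d : wact (w := sh_mod 0 N) c (f m d) + wrmul (N := sh_mod 0 N) (f n c) d = wact c (f m d) + wrmul (f n c) d.
  by rewrite (wrmul_sh_mod (p := 0)) // wcast_id /= sh0_act.
split=> -[h1 h2].
  split; first exact: (proj1 (sh0_wmor _) h1).
  by move=> n m c d; rewrite h2 E.
split; first exact: (proj2 (sh0_wmor _) h1).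
by move=> n m c d; rewrite h2 E.
Qed.

(* The action (c f)(x) = c (f x) on Der(C,N) and Hom_C(M,N). *)
Definition fam_act (C : comWheelgebra) (S : wheelData) (N : wheelmodule C)
    q p (c : C q) (f : fam S N p) : fam S N (q + p) :=
  fun n x => wcast (addnA q p n) (wact c (f n x : N (p + n)%N)).

Record kahler (C : comWheelgebra) := Kahler {
  forms1 : wheelmodule C;
  (* The isomorphism and its inverse; their values outside of Der(C,N) and
     Hom_C(forms1,N) are irrelevant. *)
  to_hom : forall (N : wheelmodule C) p, fam C N p -> fam forms1 N p;
  to_der : forall (N : wheelmodule C) p, fam forms1 N p -> fam C N p;
  to_hom_iHom : forall (N : wheelmodule C) p (f : fam C N p),
    iDer f -> iHom (to_hom f);
  to_der_iDer : forall (N : wheelmodule C) p (g : fam forms1 N p),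
    iHom g -> iDer (to_der g);
  to_homK : forall (N : wheelmodule C) p (f : fam C N p),
    iDer f -> eqfam (to_der (to_hom f)) f;
  to_derK : forall (N : wheelmodule C) p (g : fam forms1 N p),
    iHom g -> eqfam (to_hom (to_der g)) g;
  to_hom_lin : forall (N : wheelmodule C) p a (f g : fam C N p),
    iDer f -> iDer g ->
    eqfam (to_hom (fam_lin a f g)) (fam_lin a (to_hom f) (to_hom g));
  to_hom_permL : forall (N : wheelmodule C) p (s : 'S_p) (f : fam C N p),
    iDer f -> eqfam (to_hom (fam_permL s f)) (fam_permL s (to_hom f));
  to_hom_permR : forall (N : wheelmodule C) p (s : 'S_p) (f : fam C N p),
    iDer f -> eqfam (to_hom (fam_permR s f)) (fam_permR s (to_hom f));
  to_hom_contr : forall (N : wheelmodule C) p (j i : 'I_p.+1)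
      (f : fam C N p.+1),
    iDer f -> eqfam (to_hom (fam_contr j i f)) (fam_contr j i (to_hom f));
  to_hom_act : forall (N : wheelmodule C) q p (c : C q) (f : fam C N p),
    iDer f -> eqfam (to_hom (fam_act c f)) (fam_act c (to_hom f));
  to_hom_nat : forall (N N' : wheelmodule C) (u : forall n, N n -> N' n) p
      (f : fam C N p),
    is_wmodmor u -> iDer f ->
    eqfam (@to_hom N' p (fun n x => u (p + n)%N (f n x)))
          (fun n x => u (p + n)%N (to_hom f x)) }.

Arguments to_hom {C} k N {p} f [n] x : rename.
Arguments to_der {C} k N {p} g [n] c : rename.

Definition kahler_d (C : comWheelgebra) (W : kahler C) :
  fam C (forms1 W) 0 := to_der W (forms1 W) (p := 0) (fun n x => x).

(* The objects of the category G: a wheelgebra D = (+)_d D_d, where gcomp d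
   is membership in D_d, with an isomorphism gincl of C onto D_0. *)
Record is_graded (C : comWheelgebra) (D : wheelgebra)
    (gcomp : nat -> forall n, D n -> Prop) (gincl : forall n, C n -> D n) :
    Prop := IsGraded {
  gcomp0 : forall d n, gcomp d n 0;
  gcomp_lin : forall d n (a : K) (u v : D n),
    gcomp d n u -> gcomp d n v -> gcomp d n (a *: u + v);
  gcomp_permL : forall d n (s : 'S_n) u, gcomp d n u -> gcomp d n (permL s u);
  gcomp_permR : forall d n (s : 'S_n) u, gcomp d n u -> gcomp d n (permR s u);
  gcomp_contr : forall d n (j i : 'I_n.+1) u,
    gcomp d n.+1 u -> gcomp d n (contr j i u);
  gcomp_sum : forall n (v : D n), exists (b : nat) (u : nat -> D n),
    (forall d, gcomp d n (u d)) /\ v = \sum_(d < b) u d;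
  gcomp_direct : forall n (b : nat) (u : nat -> D n),
    (forall d, gcomp d n (u d)) -> \sum_(d < b) u d = 0 ->
    forall d, (d < b)%N -> u d = 0;
  gcomp_mul : forall d e n m (u : D n) (v : D m),
    gcomp d n u -> gcomp e m v -> gcomp (d + e)%N (n + m)%N (wmul u v);
  gcomm : forall d e n m (u : D n) (v : D m),
    gcomp d n u -> gcomp e m v ->
    wmul u v = (-1) ^+ (d * e) *: block_flip (wmul v u);
  gincl_mor : is_wgmor gincl;
  gincl_inj : forall n, injective (gincl n);
  gincl_im : forall n (u : D n), gcomp 0 n u <-> exists c, u = gincl n c }.

Record gWheelgebra (C : comWheelgebra) := GWheelgebra {
  gw :> wheelgebra;
  gcomp : nat -> forall n, gw n -> Prop;
  gincl : forall n, C n -> gw n;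
  gwP : is_graded gcomp gincl }.

Record is_gmor (C : comWheelgebra) (D E : gWheelgebra C)
    (f : forall n, D n -> E n) : Prop := IsGmor {
  gmor_wgmor : is_wgmor f;
  gmor_comp : forall d n (u : D n), gcomp d u -> gcomp d (f n u);
  gmor_incl : forall n (c : C n), f n (gincl D c) = gincl E c }.

(* D as a C-wheelmodule data, by restriction along C = D_0 *)
Definition gmod (C : comWheelgebra) (D : gWheelgebra C) : wmodData C :=
  @WmodData C D (fun n m c x => wmul (gincl D c) x).

(* Hom_C(M, D_1) *)
Definition is_mor1 (C : comWheelgebra) (M : wheelmodule C) (D : gWheelgebra C)
    (f : forall n, M n -> D n) : Prop :=
  is_wmodmor (N := gmod D) f /\ forall n (x : M n), gcomp 1 (f n x).

(* Homogeneity of degree e (in Z), the components of negative degree being 0 *)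
Definition homog (C : comWheelgebra) (D : gWheelgebra C) (e : int) p
    (f : fam D D p) : Prop :=
  forall d n (u : D n), gcomp d u ->
    (forall d' : nat, d'%:Z = d%:Z + e -> gcomp d' (f n u : D (p + n)%N)) /\
    (d%:Z + e < 0 -> f n u = 0).

(* Elements of Der(D)(p), with D graded, homogeneous of degree e; the sign is
   the Koszul sign (-1)^(e d). *)
Record is_gder (C : comWheelgebra) (D : gWheelgebra C) (e : int) p
    (f : fam D D p) : Prop := IsGder {
  gder_wmor : is_wmor f;
  gder_homog : homog e f;
  gder_mul : forall d n m (u : D n) (v : D m), gcomp d u ->
    f _ (wmul u v) =
      wcast (esym (addnA p n m)) (wmul (f n u : D (p + n)%N) v)
      + (-1) ^+ (`|e|%N * d) *:
        sh_act (N := wreg_data D) u (f m v : D (p + m)%N) }.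

Definition comp_endo (S : wheelData) (f g : fam S S 0) : fam S S 0 :=
  fun n x => f n (g n x).

Record gKahler (C : comWheelgebra) := GKahler {
  gk_kahler :> kahler C;
  forms : gWheelgebra C;
  iota : forall n, forms1 gk_kahler n -> forms n;
  iota_mor1 : is_mor1 iota;
  forms_ex : forall (D : gWheelgebra C) (g : forall n, forms1 gk_kahler n -> D n),
    is_mor1 g -> exists f : forall n, forms n -> D n,
      is_gmor f /\ forall n x, f n (iota x) = g n x;
  forms_uniq : forall (D : gWheelgebra C) (f f' : forall n, forms n -> D n),
    is_gmor f -> is_gmor f' -> (forall n x, f n (@iota n x) = f' n (iota x)) ->
    forall n u, f n u = f' n u }.

Record dgKahler (C : comWheelgebra) := DgKahler {
  dgk_gkahler :> gKahler C;
  dgD : fam (forms dgk_gkahler) (forms dgk_gkahler) 0;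
  dgD_der : is_gder 1 dgD;
  dgD_sq : forall n u, dgD (dgD u) = 0 :> forms dgk_gkahler n;
  dgD_incl : forall n (c : C n),
    dgD (gincl (forms dgk_gkahler) c) =
    iota (kahler_d dgk_gkahler c : forms1 dgk_gkahler n) }.

Arguments dgD {C} d [n] u : rename.

(* The restriction of d to forms1 is g, where forms1 is seen inside forms
   through iota and C through gincl. *)
Definition restricts_to (C : comWheelgebra) (W : gKahler C) p
    (d : fam (forms W) (forms W) p) (g : fam (forms1 W) (wreg C) p) : Prop :=
  forall n (x : forms1 W n),
    d n (iota x) = gincl (forms W) (g n x : C (p + n)%N).

(* The restriction Der^{-1}(forms) -> Hom_C(forms1, C) is bijective, with
   inverse wc.  Restrictions do lie in Hom_C(forms1, C) since derivations of
   degree -1 vanish on C; a bijective morphism of wheelspaces is an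
   isomorphism. *)
Record wheelcontractions (C : comWheelgebra) (W : gKahler C) :=
  Wheelcontractions {
  wc : forall p, fam (forms1 W) (wreg C) p -> fam (forms W) (forms W) p;
  wc_der : forall p (g : fam (forms1 W) (wreg C) p),
    iHom g -> is_gder (-1) (wc g);
  wc_restr : forall p (g : fam (forms1 W) (wreg C) p),
    iHom g -> restricts_to (wc g) g;
  wc_inj : forall p (d d' : fam (forms W) (forms W) p),
    is_gder (-1) d -> is_gder (-1) d' ->
    (forall n (x : forms1 W n), d n (iota x) = d' n (iota x)) -> eqfam d d' }.

Definition der_ext (C : comWheelgebra) (W : gKahler C) (E : wheelcontractions W) p
    (X : fam C (wreg C) p) : fam (forms W) (forms W) p :=
  wc E (to_hom W (wreg C) X).

Definition contraction (C : comWheelgebra) (W : gKahler C)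
    (E : wheelcontractions W) (X : fam C (wreg C) 0) :
  fam (forms W) (forms W) 0 := der_ext E X.

Definition lie (C : comWheelgebra) (W : dgKahler C)
    (E : wheelcontractions W) (X : fam C (wreg C) 0) :
  fam (forms W) (forms W) 0 :=
  fun n u => dgD W (contraction E X u) + contraction E X (dgD W u).

(* Graded commutator of endomorphisms f, g homogeneous of degrees p, q *)
Definition gbracket (S : wheelData) (p q : int) (f g : fam S S 0) :
  fam S S 0 :=
  fun n x => f n (g n x) - (-1) ^+ `|(p * q)%R|%N *: g n (f n x).

Definition der_bracket (C : comWheelgebra) (X Y : fam C (wreg C) 0) :
  fam C (wreg C) 0 := fun n c => X n (Y n c) - Y n (X n c).

Lemma zmod_aux (V : zmodType) (a b c d e f : V) :
  - (a + b + (c + d)) + (e + c + (b + f)) = - a + e + (- d + f).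
Proof.
rewrite !opprD [LHS](AC ((2*2)*(2*2)) (((1*5)*(4*8))*((7*2)*(6*3)))).
by rewrite /= !subrr !addr0.
Qed.

Lemma der_bracket_iDer (C : comWheelgebra) (X Y : fam C (wreg C) 0) :
  iDer X -> iDer Y -> iDer (der_bracket X Y).
Proof.
move=> /iDer0[[a1 a2 a3 a4] a5] /iDer0[[b1 b2 b3 b4] b5]; apply/iDer0.
have h := wsP C.
have W n m (c : C n) (d : C m) : wrmul (N := wreg_data C) c d = wmul c d.
  by rewrite /wrmul /= -cwgP.
have aD n : {morph X n : x y / x + y} by move=> x y; rewrite -[x]scale1r a1 !scale1r.
have bD n : {morph Y n : x y / x + y} by move=> x y; rewrite -[x]scale1r b1 !scale1r.
have SB n (v1 v2 : C n) : v1 - v2 = -1 *: v2 + v1 by rewrite scaleN1r addrC.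
split; first split.
- move=> n a u v; rewrite /der_bracket a1 b1 a1 b1 scalerBr opprD !addrA; congr (_ - _).
  by rewrite -!addrA; congr (_ + _); rewrite addrC.
- move=> n s v; rewrite /der_bracket a2 b2 a2 b2.
  by rewrite !SB (permL_linear h).
- move=> n s v; rewrite /der_bracket a3 b3 a3 b3.
  by rewrite !SB (permR_linear h).
- move=> n j i v; rewrite /der_bracket a4 b4 a4 b4.
  by rewrite !SB (contr_linear h).
- move=> n m c d; rewrite /der_bracket a5 b5 !W /= aD bD a5 b5 a5 b5 !W /=.
  rewrite !SB (wmul_linearl (wgP C)) (wmul_linearr (wgP C)) !scaleN1r.
  exact: zmod_aux.
Qed.

End Wheelspaces.

Arguments to_hom {K C} k N {p} f [n] x : rename.
Arguments to_der {K C} k N {p} g [n] c : rename.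
Arguments dgD {K C} d [n] u : rename.

(* Main.v *)
Require Import Defs.
From mathcomp Require Import all_boot all_order all_algebra all_fingroup.
From mathcomp Require Import zify ssrAC.
From Stdlib Require Import FunctionalExtensionality.
Import GRing.Theory Num.Theory.
Local Open Scope ring_scope.

(** The identities of Cartan calculus are equalities between graded commutators
of derivations of the algebra of forms, so they follow once it is known that
such commutators are again derivations ([gder_bracket]) and that a derivation
is determined by its values on generators.  Two determination principles are
needed, one for each negative degree that occurs.

In degree -1, a derivation f vanishes on C, so that f restricted to 1-forms is
C-linear with values in the C-module of forms.  By naturality of the Kähler
isomorphism a C-linear map on 1-forms is determined by its composite with the
universal derivation d ([wmodmor_uniq]), and by the uniqueness of
wheelcontractions f is determined by its restriction to 1-forms.  Hence f is
determined by the values f (D c), for c in C ([gder_neg_uniq]).  For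
[L_X, i_Y] this value is X (Y c) - Y (X c), because i_X (D c) = X c and
L_X c = X c; this is i_[X,Y] (D c).

In degree -2, the wheelcontractions say nothing, and the universal property of
the algebra of forms is used instead.  Let F be the algebra of forms and let
F[eps], with eps^2 = 0, have eps in degree 2.  Its degree-0 part is still C.
If f is a derivation of degree -2, then u |-> u + eps f(u) is a morphism
F -> F[eps] of graded wheelgebras under C, hence is determined by its values on
1-forms ([gder_even_uniq]).  Since [i_X, i_Y] kills 1-forms for degree reasons,
it is zero.  The same argument cannot be used for degree 0, where eps would
enlarge the degree-0 part.

The remaining identities are formal.  As D D = 0, D commutes with
L_X = D i_X + i_X D, and then
[L_X, L_Y] = [L_X, [D, i_Y]] = [D, [L_X, i_Y]] = [D, i_[X,Y]] = L_[X,Y]. *)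

(** * Linear maps, Koszul signs and morphisms of wheelspaces *)

Section Linear.
Context {K : fieldType} {U V : lmodType K} {f : U -> V} (lf : linear f).
Lemma linear_0 : f 0 = 0.
Proof. by have := lf (-1) 0 0; rewrite scaler0 addr0 scaleN1r addNr. Qed.
Lemma linear_D u v : f (u + v) = f u + f v.
Proof. by have := lf 1 u v; rewrite !scale1r. Qed.
Lemma linear_Z a u : f (a *: u) = a *: f u.
Proof. by have := lf a u 0; rewrite linear_0 !addr0. Qed.
Lemma linear_B u v : f (u - v) = f u - f v.
Proof. by rewrite linear_D -scaleN1r linear_Z scaleN1r. Qed.
End Linear.

Section Sign.
Context {K : fieldType}.
Definition ksign (e : int) : K := (-1) ^+ `|e|%N.
Lemma ksignD e e' : ksign (e + e') = ksign e * ksign e'.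
Proof.
rewrite /ksign -exprD -[LHS]signr_odd -[RHS]signr_odd; congr (_ ^+ _).
by congr nat_of_bool; lia.
Qed.
Lemma ksign_sq e : ksign e * ksign e = 1.
Proof. by rewrite -expr2 sqrr_sign. Qed.
Lemma ksign_mul_even e r : ~~ odd `|r|%N -> ksign (e * r) = 1.
Proof. by move=> h; rewrite /ksign abszM -signr_odd oddM (negPf h) andbF. Qed.
End Sign.

Section Morphisms.
Context {K : fieldType}.
Lemma wmor_id (S : wheelData K) : is_wmor (fun n (x : S n) => x).
Proof. by split. Qed.

Lemma wmor_ext {S T : wheelData K} {f g : forall n, S n -> T n} :
  (forall n x, f n x = g n x) -> is_wmor f -> is_wmor g.
Proof.
move=> E [f1 f2 f3 f4]; split.
- by move=> n a u v; rewrite -!E f1.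
- by move=> n s v; rewrite -!E f2.
- by move=> n s v; rewrite -!E f3.
- by move=> n j i v; rewrite -!E f4.
Qed.

Lemma wmor_comp {S T U : wheelData K} {f : forall n, T n -> U n} {g : forall n, S n -> T n} :
  is_wmor f -> is_wmor g -> is_wmor (fun n x => f n (g n x)).
Proof.
move=> [f1 f2 f3 f4] [g1 g2 g3 g4]; split.
- by move=> n a u v; rewrite g1 f1.
- by move=> n s v; rewrite g2 f2.
- by move=> n s v; rewrite g3 f3.
- by move=> n j i v; rewrite g4 f4.
Qed.

Lemma wmor_lin {S T : wheelData K} (hT : is_wheelspace T) (a : K)
    {f g : forall n, S n -> T n} :
  is_wmor f -> is_wmor g -> is_wmor (fun n x => a *: f n x + g n x).
Proof.
move=> [f1 f2 f3 f4] [g1 g2 g3 g4]; split.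
- move=> n b u v; rewrite f1 g1 !scalerDr !scalerA [a * b]mulrC.
  by rewrite -!addrA; congr (_ + _); rewrite addrCA.
- by move=> n s v; rewrite f2 g2 (permL_linear hT).
- by move=> n s v; rewrite f3 g3 (permR_linear hT).
- by move=> n j i v; rewrite f4 g4 (contr_linear hT).
Qed.

Lemma wmor_zero {S T : wheelData K} : is_wheelspace T -> is_wmor (fun n (x : S n) => 0 : T n).
Proof.
move=> hT; split.
- by move=> n a u v; rewrite scaler0 addr0.
- by move=> n s v; rewrite (linear_0 (permL_linear hT s)).
- by move=> n s v; rewrite (linear_0 (permR_linear hT s)).
- by move=> n j i v; rewrite (linear_0 (contr_linear hT j i)).
Qed.

Lemma block_flip_linear {S : wheelData K} (hS : is_wheelspace S) m n :
  linear (@block_flip K S m n).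
Proof.
by move=> a u v; rewrite /block_flip (permL_linear hS) wcast_linear (permR_linear hS).
Qed.

Lemma block_flip_wmor {S T : wheelData K} {f : forall n, S n -> T n} m n (v : S (m + n)%N) :
  is_wmor f -> f _ (block_flip v) = block_flip (f _ v).
Proof.
move=> [_ fL fR _]; rewrite /block_flip fR; congr permR; rewrite -fL.
by case: _ / (addnC m n).
Qed.

Section Linearity.
Context {S T : wheelData K} {f : forall n, S n -> T n} (hf : is_wmor f).
Lemma wmor0 n : f n 0 = 0.
Proof. exact: (linear_0 (wmor_linear hf (n:=n))). Qed.
Lemma wmorD n u v : f n (u + v) = f n u + f n v.
Proof. exact: (linear_D (wmor_linear hf (n:=n))). Qed.
Lemma wmorZ n a u : f n (a *: u) = a *: f n u.
Proof. exact: (linear_Z (wmor_linear hf (n:=n))). Qed.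
Lemma wmorB n u v : f n (u - v) = f n u - f n v.
Proof. exact: (linear_B (wmor_linear hf (n:=n))). Qed.
End Linearity.
End Morphisms.

(** The cancellation behind the Leibniz rule of a graded commutator: t and t'
are the signs of moving the two derivations past the first factor, s that of
exchanging them, and the mixed terms b and c cancel since s is an involution. *)
Lemma signed_leibniz {K : fieldType} {V : lmodType K} (s t t' : K) (a a' b c x x' : V) :
  s * s = 1 ->
  (a + (t * s) *: b) + t' *: (c + t *: x)
    - s *: ((a' + (t' * s) *: c) + t *: (b + t' *: x'))
  = (a - s *: a') + (t * t') *: (x - s *: x').
Proof.
move=> ss; rewrite !scalerDr !scalerN !scalerA !opprD.
have -> : s * (t' * s) = t' by rewrite mulrCA ss mulr1.
rewrite [t' * t]mulrC [t * s]mulrC [t * t' * s]mulrC ?mulrA.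
rewrite [LHS](AC ((2*2)*((1*1)*2)) (((1*5)*(4*8))*((2*7)*(3*6)))) /=.
by rewrite !subrr !addr0.
Qed.

(** * Homogeneous elements and graded derivations *)

Section Graded.
Context {K : fieldType} {C : comWheelgebra K} (D : gWheelgebra C).
Let hD := wsP D.
Let wD := wgP D.

(** Integer degrees let a derivation of negative degree shift degrees without
case distinctions. *)
Definition gcompZ (e : int) n (u : D n) : Prop :=
  (forall d : nat, d%:Z = e -> gcomp d u) /\ (e < 0 -> u = 0).

Lemma gcompZ0 e n : gcompZ e n 0.
Proof. by split=> // d _; apply: (gcomp0 (gwP D)). Qed.

Lemma gcompZ_nat d n (u : D n) : gcompZ d%:Z n u <-> gcomp d u.
Proof. by split=> [[h _]|h]; [exact: h | split=> // d' [->]]. Qed.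

Variant gcompZ_spec (e : int) n (u : D n) : Prop :=
| GcompZNat d of e = d%:Z & gcomp d u
| GcompZNeg of u = 0.

Lemma gcompZP {e n} {u : D n} : gcompZ e n u -> gcompZ_spec e n u.
Proof.
move=> [h1 h2]; case: (ltrP e 0) => he; first by right; exact: h2.
by apply: (@GcompZNat _ _ _ `|e|%N); [lia | apply: h1; lia].
Qed.

Lemma gcompZ_lin e n (a : K) (u v : D n) :
  gcompZ e n u -> gcompZ e n v -> gcompZ e n (a *: u + v).
Proof.
move=> [u1 u2] [v1 v2]; split=> [d hd|he].
  by apply: (gcomp_lin (gwP D)); [exact: u1 | exact: v1].
by rewrite u2 // v2 // scaler0 addr0.
Qed.

Lemma mul0w n m (v : D m) : wmul (0 : D n) v = 0.
Proof. exact: (linear_0 (wmul_linearl wD v)). Qed.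
Lemma mulw0 n m (u : D n) : wmul u (0 : D m) = 0.
Proof. exact: (linear_0 (wmul_linearr wD u)). Qed.

Lemma gcompZ_mul d e n m (u : D n) (v : D m) :
  gcompZ d n u -> gcompZ e m v -> gcompZ (d + e) (n + m)%N (wmul u v).
Proof.
move=> /gcompZP[d' -> hu|->]; last by rewrite mul0w => _; exact: gcompZ0.
move=> /gcompZP[e' -> hv|->]; last by rewrite mulw0; exact: gcompZ0.
by rewrite -PoszD; apply/gcompZ_nat; exact: (gcomp_mul (gwP D)).
Qed.

Lemma gcompZ_comm d e n m (u : D n) (v : D m) :
  gcompZ d n u -> gcompZ e m v -> wmul u v = ksign (d * e) *: block_flip (wmul v u).
Proof.
have z := linear_0 (block_flip_linear hD m n).
move=> /gcompZP[d' -> hu|->]; last by rewrite mul0w mulw0 z scaler0.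
move=> /gcompZP[e' -> hv|->]; last by rewrite mul0w mulw0 z scaler0.
by rewrite /ksign abszM; exact: (gcomm (gwP D)).
Qed.

Lemma gincl_gcomp n (c : C n) : gcomp 0 (gincl D c).
Proof. by apply/(gincl_im (gwP D)); exists c. Qed.

Implicit Types f g : fam D D 0.

Lemma gder_wmor0 {e f} : is_gder e f -> is_wmor (T := D) f.
Proof. by case=> /sh0_wmor. Qed.

Lemma gder_gcompZ {e f} : is_gder e f ->
  forall d n (u : D n), gcompZ d n u -> gcompZ (d + e) n (f n u).
Proof.
move=> hf d n u /gcompZP[d' -> hu|->]; first by case: hf => _ hf _; exact: hf.
by rewrite (wmor0 (gder_wmor0 hf)); exact: gcompZ0.
Qed.

Lemma gder_gcomp0 {e f} : is_gder e f -> (e < 0) ->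
  forall n (u : D n), gcomp 0 u -> f n u = 0.
Proof. by move=> [_ hf _] he n u /hf [_ ->] //; rewrite add0r. Qed.

(** At arity 0 the shifted action is the original one, so the Leibniz rule
takes its usual form; stating it for integer degrees allows it to be applied
to f(u) when f lowers the degree. *)
Lemma gderE {e f} : is_gder e f <->
  [/\ is_wmor (T := D) f, homog e f &
   forall d n m (u : D n) (v : D m), gcompZ d n u ->
    f _ (wmul u v) = (wmul (f n u : D n) v : D (n + m)%N)
      + ksign (e * d) *: (wmul u (f m v : D m) : D (n + m)%N)].
Proof.
split=> [[h1 h2 h3]|[h1 h2 h3]].
  have h1' := proj1 (sh0_wmor _) h1.
  split=> // d n m u v /gcompZP[d' -> hu|->].
    rewrite (h3 _ _ _ _ _ hu) wcast_id sh0_act //; first by rewrite /ksign abszM.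
    exact: wreg_is_wheelmodule.
  by rewrite !(mul0w, wmor0 h1') scaler0 addr0.
split=> //; first exact/sh0_wmor.
move=> d n m u v hu; rewrite (h3 d) ?wcast_id ?sh0_act.
- by rewrite /ksign abszM.
- exact: wreg_is_wheelmodule.
- exact/gcompZ_nat.
Qed.

Lemma gder_zero e : is_gder e (fun n (u : D n) => 0 : sh 0 D n).
Proof.
apply/gderE; split; first exact: (wmor_zero (T := D)).
  by move=> d n u _; exact: gcompZ0.
by move=> d n m u v _; rewrite mul0w mulw0 scaler0 addr0.
Qed.

(** The sign picked up by f on g(u) v is that of the degree d + e' of g(u);
multiplicativity of the sign splits it into the two signs of the commutator. *)
Lemma gder_bracket {e e' f g} :
  is_gder e f -> is_gder e' g -> is_gder (e + e') (gbracket e e' f g).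
Proof.
move=> hf hg; have gf := gder_gcompZ hf; have gg := gder_gcompZ hg.
have /gderE[wf _ Lf] := hf; have /gderE[wg _ Lg] := hg.
have E n (u : D n) :
  gbracket e e' f g u = (- ksign (e * e')) *: (g n (f n u)) + f n (g n u) :> D n.
  by rewrite /gbracket scaleNr addrC.
apply/gderE; split.
- have h := wmor_lin hD (- ksign (e * e')) (wmor_comp wg wf) (wmor_comp wf wg).
  by apply: wmor_ext h => n u; rewrite -E.
- move=> d n u /gcompZ_nat hu; rewrite -/(gcompZ _ _ _) E; apply: gcompZ_lin.
    by rewrite addrA; apply: gg; exact: gf.
  by rewrite [e + e']addrC addrA; apply: gf; exact: gg.
- move=> d n m u v hu; rewrite /gbracket.
  rewrite (Lg d) // (Lf d) // (wmorD wf) (wmorD wg) (wmorZ wf) (wmorZ wg).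
  rewrite (Lf (d + e') _ _ (g n u) v (gg _ _ _ hu)) (Lg (d + e) _ _ (f n u) v (gf _ _ _ hu)).
  rewrite (Lf d _ _ u (g m v) hu) (Lg d _ _ u (f m v) hu).
  rewrite !mulrDr [e' * e]mulrC !ksignD mulrDl ksignD.
  rewrite (linear_B (wmul_linearl wD _)) (linear_B (wmul_linearr wD _)).
  rewrite (linear_Z (wmul_linearl wD _)) (linear_Z (wmul_linearr wD _)).
  exact: signed_leibniz (ksign_sq _).
Qed.

End Graded.

(** * Dual numbers over a wheelgebra *)

Section DualNumbers.
Context {K : fieldType}.

(** The pair (a, b) stands for a + eps b. *)
Definition dual_data (S : wheelData K) : wheelData K := {|
  car := fun n => (S n * S n)%type : lmodType K;
  permL := fun n s v => (permL s v.1, permL s v.2);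
  permR := fun n s v => (permR s v.1, permR s v.2);
  contr := fun n j i v => (contr j i v.1, contr j i v.2) |}.

Lemma wcast_dual (S : wheelData K) n m (e : n = m) (v : dual_data S n) :
  wcast e v = (wcast e v.1, wcast e v.2).
Proof. by case: m / e; case: v. Qed.

Lemma block_flip_dual (S : wheelData K) m n (v : dual_data S (m + n)%N) :
  block_flip v = (block_flip v.1, block_flip v.2).
Proof. by rewrite /block_flip wcast_dual. Qed.

Lemma dual_is_wheelspace (S : wheelData K) :
  is_wheelspace S -> is_wheelspace (dual_data S).
Proof.
move=> [h1 h2 h3 h4 h5 h6 h7 h8 h9 h10]; split=> /=.
- by move=> n s a u v; rewrite /= !h1.
- by move=> n s a u v; rewrite /= !h2.
- by move=> n [u v] /=; rewrite !h3.
- by move=> n [u v] /=; rewrite !h4.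
- by move=> n s t v; rewrite !h5.
- by move=> n s t v; rewrite !h6.
- by move=> n s t v; rewrite !h7.
- by move=> n j i a u v; rewrite /= !h8.
- by move=> n s t j i v; rewrite !h9.
- by move=> n j i l k v; congr (_, _); exact: h10.
Qed.

Variable A : wheelgebra K.
Let hA := wsP A.
Let mA := wgP A.

Definition dual_space : wheelspace K := Wheelspace (dual_is_wheelspace _ (wsP A)).

Definition dual_mul n m (u : dual_space n) (v : dual_space m) :
  dual_space (n + m)%N := (wmul u.1 v.1, wmul u.1 v.2 + wmul u.2 v.1).

Lemma dual_is_wheelgebra : is_wheelgebra dual_mul (wone A, 0).
Proof.
have [h1 h2 h3 h4 h5 h6 h7 h8 h9] := mA.
split=> /=.
- move=> n m b a u v; rewrite /dual_mul /= !h1; congr (_, _).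
  by rewrite -[RHS]/(a *: (_ + _) + (_ + _)) scalerDr [LHS](AC (2*2) ((1*3)*(2*4))).
- move=> n m b a u v; rewrite /dual_mul /= !h2; congr (_, _).
  by rewrite -[RHS]/(a *: (_ + _) + (_ + _)) scalerDr [LHS](AC (2*2) ((1*3)*(2*4))).
- move=> n m s t a b; rewrite /dual_mul /= !h3; congr (_, _).
  by rewrite (linear_D (permL_linear hA _)).
- move=> n m s t a b; rewrite /dual_mul /= !h4; congr (_, _).
  by rewrite (linear_D (permR_linear hA _)).
- move=> n m p a b c; rewrite wcast_dual /dual_mul /= !h5; congr (_, _).
  rewrite (linear_D (h1 _ _ _)) (linear_D (h2 _ _ _)) !h5.
  by rewrite !(linear_D (@wcast_linear _ _ _ _ _)) addrA.
- move=> n [a b]; rewrite /dual_mul /= !h6.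
  by rewrite (linear_0 (h1 _ _ _)) addr0.
- move=> n [a b]; rewrite wcast_dual /dual_mul /= h7.
  by rewrite (linear_0 (h2 _ _ _)) add0r h7.
- move=> n m j i a b; rewrite /dual_mul /= h8; congr (_, _).
  by rewrite (linear_D (contr_linear hA _ _)) !h8.
- move=> n m j i a b; rewrite wcast_dual /dual_mul /= h9; congr (_, _).
  rewrite (linear_D (@wcast_linear _ _ _ _ _)) (linear_D (contr_linear hA _ _)).
  by rewrite !h9.
Qed.

Definition dual_wheelgebra : wheelgebra K := Wheelgebra dual_is_wheelgebra.

End DualNumbers.

(** * Graded dual numbers with an infinitesimal of even degree *)

Section GradedDual.
Context {K : fieldType} {C : comWheelgebra K} (D : gWheelgebra C).
Variables (r : nat) (r_gt0 : (0 < r)%N) (r_even : ~~ odd r).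
Let hD := wsP D.
Let mD := wgP D.
Let gD := gwP D.

(** Here eps has degree r.  The parity of r makes eps commute with everything
without signs; its positivity keeps the degree-0 part of the dual numbers equal
to C. *)
Definition dual_gcomp (d : nat) n (u : dual_wheelgebra D n) : Prop :=
  gcomp d u.1 /\ gcompZ D (d%:Z - r%:Z) n u.2.

Definition dual_incl n (c : C n) : dual_wheelgebra D n := (gincl D c, 0).

(** The map u |-> u + eps f(u); it is multiplicative exactly when f satisfies
the Leibniz rule without sign. *)
Definition dual_graph (f : fam D D 0) n (u : D n) : dual_wheelgebra D n :=
  (u, f n u).

(** The Leibniz rule is imposed on a homogeneous first factor only; in even
degree the sign is trivial and the rule extends to sums. *)
Lemma gder_even_mul {e : int} {f : fam D D 0} : is_gder e f -> ~~ odd `|e|%N ->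
  forall n m (u : D n) (v : D m),
  f _ (wmul u v) = (wmul (f n u : D n) v : D (n + m)%N) + wmul u (f m v : D m).
Proof.
move=> hf he n m u v; have /gderE[wf _ Lf] := hf.
have [b [w [hw ->]]] := gcomp_sum gD u.
elim/big_ind: _ => [|x y Ex Ey|d _].
- by rewrite !(mul0w, wmor0 wf) addr0.
- rewrite (linear_D (wmul_linearl mD v)) !(wmorD wf) Ex Ey.
  rewrite !(linear_D (wmul_linearl mD _)).
  by rewrite [LHS](AC (2*2) ((1*3)*(2*4))).
- rewrite (Lf d); last exact/gcompZ_nat.
  by rewrite mulrC ksign_mul_even // scale1r.
Qed.

Lemma dual_graph_wgmor {e : int} {f : fam D D 0} :
  is_gder e f -> ~~ odd `|e|%N -> is_wgmor (B := dual_wheelgebra D) (dual_graph f).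
Proof.
move=> hf he; have Lf := gder_even_mul hf he; have wf := gder_wmor0 D hf.
split.
- split.
  + by move=> n a u v; rewrite /dual_graph (wmor_linear wf).
  + by move=> n s v; rewrite /dual_graph (wmor_permL wf).
  + by move=> n s v; rewrite /dual_graph (wmor_permR wf).
  + by move=> n j i v; rewrite /dual_graph (wmor_contr wf).
- by move=> n m u v; rewrite /dual_graph Lf addrC.
(* f(1) = f(1 1) = f(1) + f(1) *)
- have := Lf _ _ (wone D) (wone D); rewrite (wmul1l mD) (wmul1l mD).
  have := wmul1r mD (f 0%N (wone D)); rewrite wcast_id => ->.
  by move=> /esym/eqP; rewrite -subr_eq0 addrK /dual_graph => /eqP ->.
Qed.

Lemma dual_sum n (b : nat) (u : nat -> dual_wheelgebra D n) :
  \sum_(d < b) u d = (\sum_(d < b) (u d).1, \sum_(d < b) (u d).2).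
Proof. by elim/big_rec3: _ => // i x y z _ -> /=; case: (u i). Qed.

Lemma sum_shift {V : nmodType} (w : nat -> V) (b : nat) :
  \sum_(d < r + b) (if (r <= d)%N then w (d - r)%N else 0) = \sum_(d < b) w d.
Proof.
rewrite big_split_ord /= big1 ?add0r.
  by apply: eq_bigr => i _; rewrite leq_addr addKn.
by move=> i _; rewrite leqNgt ltn_ord.
Qed.

Lemma sum_pad {V : nmodType} (w : nat -> V) (b c : nat) :
  \sum_(d < b + c) (if (d < b)%N then w d else 0) = \sum_(d < b) w d.
Proof.
rewrite big_split_ord /= [X in _ + X]big1 ?addr0.
  by apply: eq_bigr => i _; rewrite ltn_ord.
by move=> i _; rewrite ltnNge leq_addr.
Qed.

Lemma dual_is_graded :
  is_graded (D := dual_wheelgebra D) dual_gcomp dual_incl.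
Proof.
split.
- by move=> d n; split; [exact: (gcomp0 gD) | exact: gcompZ0].
- move=> d n a u v [u1 u2] [v1 v2]; split; first exact: (gcomp_lin gD).
  exact: gcompZ_lin.
- move=> d n s u [u1 [u2 u3]]; split; first exact: (gcomp_permL gD).
  split=> [e he|he] /=; first by apply: (gcomp_permL gD); exact: u2.
  by rewrite u3 // (linear_0 (permL_linear hD s)).
- move=> d n s u [u1 [u2 u3]]; split; first exact: (gcomp_permR gD).
  split=> [e he|he] /=; first by apply: (gcomp_permR gD); exact: u2.
  by rewrite u3 // (linear_0 (permR_linear hD s)).
- move=> d n j i u [u1 [u2 u3]]; split; first exact: (gcomp_contr gD).
  split=> [e he|he] /=; first by apply: (gcomp_contr gD); exact: u2.
  by rewrite u3 // (linear_0 (contr_linear hD j i)).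
(* The component of degree d of v2 contributes to degree d + r of the pair; the
   bound is large enough for both sequences padded by zeros. *)
- move=> n [v1 v2].
  have [b1 [u1 [h1 E1]]] := gcomp_sum gD v1.
  have [b2 [u2 [h2 E2]]] := gcomp_sum gD v2.
  pose w1 d := if (d < b1)%N then u1 d else 0.
  pose w2 d := if (d < b2)%N then u2 d else 0.
  pose w d : dual_wheelgebra D n := (w1 d, if (r <= d)%N then w2 (d - r)%N else 0).
  exists (r + (b1 + b2))%N, w; split.
    move=> d; split; rewrite /w /= /w1 /w2.
      by case: ifP => // _; exact: (gcomp0 gD).
    case: (leqP r d) => hd; last exact: gcompZ0.
    case: ifP => _; last exact: gcompZ0.
    by rewrite subzn //; apply/gcompZ_nat.
  rewrite dual_sum /= sum_shift /w1 /w2 addnCA sum_pad.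
  by rewrite addnC sum_pad -E1 -E2.
- move=> n b u hu; rewrite dual_sum => -[E1 E2] d hd.
  (* The second components in degrees below r vanish; the others are shifted
     down by r to apply directness in the base algebra. *)
  have lo e : (e < r)%N -> (u e).2 = 0 by move=> he; have [_ [_ ->]] := hu e; first by []; lia.
  have E1d : (u d).1 = 0 by apply: (gcomp_direct gD) (fun e => proj1 (hu e)) E1 d hd.
  have E2d : (u d).2 = 0.
    case: (ltnP d r) => [|hr]; first exact: lo.
    have hw e : gcomp e (u (r + e)%N).2.
      by have [_] := hu (r + e)%N; rewrite PoszD addrAC subrr add0r => /gcompZ_nat.
    have [b' Eb] : exists b', b = (r + b')%N by exists (b - r)%N; lia.
    have Ew : \sum_(e < b') (u (r + e)%N).2 = 0.
      move: E2; rewrite Eb big_split_ord /= big1 ?add0r // => e _; exact: lo.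
    have := gcomp_direct gD (u := fun e => (u (r + e)%N).2) hw Ew (d := (d - r)%N).
    by rewrite subnKC //; apply; lia.
  by case: (u d) E1d E2d => x y /= -> ->.
- move=> d e n m u v [u1 u2] [v1 v2]; split; first exact: (gcomp_mul gD).
  move/gcompZ_nat in u1; move/gcompZ_nat in v1.
  rewrite /= -[wmul u.1 v.2]scale1r; apply: gcompZ_lin.
    have -> : (d + e)%:Z - r%:Z = d%:Z + (e%:Z - r%:Z) by lia.
    exact: gcompZ_mul.
  have -> : (d + e)%:Z - r%:Z = (d%:Z - r%:Z) + e%:Z by lia.
  exact: gcompZ_mul.
- move=> d e n m u v [u1 u2] [v1 v2]; rewrite block_flip_dual /=.
  rewrite -[RHS]/(_ *: _, _ *: _) /= /dual_mul.
  move/gcompZ_nat in u1; move/gcompZ_nat in v1.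
  congr (_, _); first by rewrite (gcompZ_comm D _ _ _ _ _ _ u1 v1) /ksign abszM.
  rewrite (linear_D (block_flip_linear hD _ _)) scalerDr addrC.
  rewrite (gcompZ_comm D _ _ _ _ _ _ u1 v2) (gcompZ_comm D _ _ _ _ _ _ u2 v1).
  have sr d' : ksign (d' * (- r%:Z)) = 1 :> K by apply: ksign_mul_even; rewrite abszN.
  rewrite mulrDr mulrDl !ksignD sr [- _ * _]mulrC sr !mulr1.
  by rewrite /ksign abszM.
- have [[g1 g2 g3 g4] gM g1'] := gincl_mor gD.
  have [[h1 h2 h3 h4] hM h1'] := dual_graph_wgmor (gder_zero D 0) isT.
  split; first split.
  + by move=> n a u v; rewrite /dual_incl g1; exact: h1.
  + by move=> n s v; rewrite /dual_incl g2; exact: h2.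
  + by move=> n s v; rewrite /dual_incl g3; exact: h3.
  + by move=> n j i v; rewrite /dual_incl g4; exact: h4.
  + by move=> n m a b; rewrite /dual_incl gM; exact: hM.
  + by rewrite /dual_incl g1'; exact: h1'.
- by move=> n c c' [] /(gincl_inj gD).
- move=> n u; split=> [[/(gincl_im gD)[c Ec] [_ hu]]|[c ->]]; last first.
    by split; [exact: gincl_gcomp | exact: gcompZ0].
  exists c; rewrite /dual_incl -Ec -hu; [by case: u {Ec hu}|lia].
Qed.

Definition dual_gwheelgebra : gWheelgebra C := GWheelgebra dual_is_graded.

Lemma dual_graph_gmor {f : fam D D 0} :
  is_gder (- r%:Z) f -> is_gmor (E := dual_gwheelgebra) (dual_graph f).
Proof.
move=> hf; split.
- by apply: dual_graph_wgmor hf _; rewrite abszN.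
- move=> d n u hu; split=> //=.
  by apply: (gder_gcompZ D hf); exact/gcompZ_nat.
- move=> n c; rewrite /dual_graph /= /dual_incl (gder_gcomp0 D hf) //; first lia.
  exact: gincl_gcomp.
Qed.
End GradedDual.

(** * Uniqueness principles *)

Section Kahler.
Context {K : fieldType} {C : comWheelgebra K}.

(** The graphs of f and g are morphisms from the forms to the dual numbers, and
the universal property of the forms compares them on 1-forms. *)
Lemma gder_even_uniq (W : gKahler C) (r : nat) (f g : fam (forms W) (forms W) 0) :
  (0 < r)%N -> ~~ odd r -> is_gder (- r%:Z) f -> is_gder (- r%:Z) g ->
  (forall n (x : forms1 W n), f n (Defs.iota x) = g n (Defs.iota x)) -> eqfam f g.
Proof.
move=> r_gt0 r_even hf hg Efg n u.
have mf := dual_graph_gmor _ _ r_gt0 r_even hf.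
have mg := dual_graph_gmor _ _ r_gt0 r_even hg.
suff : dual_graph (forms W) f n u = dual_graph (forms W) g n u by case.
by apply: (forms_uniq mf mg) => m x; rewrite /dual_graph Efg.
Qed.

Lemma gmod_is_wheelmodule (D : gWheelgebra C) : is_wheelmodule (gmod D).
Proof.
have [h1 h2 h3 h4 h5 h6 h7 h8 h9] := wgP D.
have [[g1 g2 g3 g4] gM g1'] := gincl_mor (gwP D).
split=> //=.
- exact: (wsP D).
- by move=> n m x a u v /=; rewrite g1 h1.
- by move=> n m s t c x; rewrite g2 h3.
- by move=> n m s t c x; rewrite g3 h4.
- by move=> n m p c d x; rewrite gM h5.
- by move=> n x; rewrite g1' h6.
- by move=> n m j i c x; rewrite h8 g4.
Qed.

Definition gmod_module (D : gWheelgebra C) : wheelmodule C :=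
  Wheelmodule (gmod_is_wheelmodule D).

(** Allows rewriting inside the arguments of the Kähler isomorphism, which is
not assumed to respect pointwise equality of functions. *)
Lemma eqfam_eq {S T : wheelData K} {p} {f g : fam S T p} : eqfam f g -> f = g.
Proof.
move=> h; apply: functional_extensionality_dep => n.
exact: functional_extensionality_dep (h n).
Qed.

Lemma der_comp {M N : wheelmodule C} {u : forall n, M n -> N n}
    {f : forall n, C n -> M n} :
  is_wmodmor u -> is_der f -> is_der (fun n c => u n (f n c)).
Proof.
move=> [wu uA] [wf fM]; split; first exact: wmor_comp.
move=> n m c d; rewrite fM (wmorD wu) uA; congr (_ + _).
by rewrite /wrmul (block_flip_wmor _ _ _ wu) uA.
Qed.

Variable W : kahler C.
Let M := forms1 W.

Lemma iHom_id : iHom (M := M) (N := M) (p := 0) (fun n x => x).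
Proof. by apply/iHom0; split=> //; exact: wmor_id. Qed.

Lemma kahler_d_der : is_der (kahler_d W : forall n, C n -> M n).
Proof. by apply/iDer0; exact: to_der_iDer iHom_id. Qed.

(** Naturality along g, applied to the universal derivation, which corresponds
to the identity of the 1-forms. *)
Lemma to_hom_comp_d {N : wheelmodule C} {g : forall n, M n -> N n} :
  is_wmodmor g ->
  eqfam (to_hom W N (p := 0) (fun n c => g n (kahler_d W c))) g.
Proof.
move=> hg n x.
have hd : iDer (kahler_d W) by apply/iDer0; exact: kahler_d_der.
by have /= -> := to_hom_nat hg hd x; rewrite (to_derK iHom_id).
Qed.

(** By the previous lemma, the derivations f and g d, with g = to_hom f,
correspond to the same map g on 1-forms. *)
Lemma to_hom_d {N : wheelmodule C} {f : fam C N 0} : iDer f ->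
  forall n (c : C n), to_hom W N f (kahler_d W c : M n) = f n c.
Proof.
move=> hf; set g := to_hom W N f.
have hg : is_wmodmor (g : forall n, M n -> N n) by apply/iHom0; exact: to_hom_iHom.
pose gd : fam C N 0 := fun n c => g n (kahler_d W c).
have hgd : iDer gd by apply/iDer0; exact: der_comp hg kahler_d_der.
have E : to_hom W N gd = g by apply/eqfam_eq; exact: to_hom_comp_d.
by move=> n c; rewrite -/(gd n c) -(to_homK W hgd) E (to_homK W hf).
Qed.

(** 1-forms behave as if generated by the exact ones: a C-linear map corresponds
to the derivation obtained by composing it with d. *)
Lemma wmodmor_uniq {N : wheelmodule C} {g g' : forall n, M n -> N n} :
  is_wmodmor g -> is_wmodmor g' ->
  (forall n (c : C n), g n (kahler_d W c) = g' n (kahler_d W c)) ->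
  forall n x, g n x = g' n x.
Proof.
move=> hg hg' E n x.
rewrite -(to_hom_comp_d hg n x) -(to_hom_comp_d hg' n x).
suff -> : (fun m (c : C m) => g m (kahler_d W c)) = (fun m c => g' m (kahler_d W c)) by [].
by apply: (eqfam_eq (S := C) (T := N) (p := 0)) => m c; exact: E.
Qed.

End Kahler.

(** * Cartan calculus *)

Section Cartan.
Context {K : fieldType} {C : comWheelgebra K} {W : dgKahler C}.
Context (E : wheelcontractions W).
Let F := forms W.
Implicit Types X Y : fam C (wreg C) 0.

(** C-linearity is the Leibniz rule on c x, where f(c) = 0 because f lowers the
degree. *)
Lemma gder_neg_mor {f : fam F F 0} : is_gder (-1) f ->
  is_wmodmor (N := gmod F) (fun n (x : forms1 W n) => f n (Defs.iota x)).
Proof.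
move=> hf; have /gderE[wf _ Lf] := hf.
have [[wi iA] _] := iota_mor1 W.
split; first exact: wmor_comp wf wi.
move=> n m c x; rewrite iA /= (Lf 0); last first.
  by apply/gcompZ_nat; exact: gincl_gcomp.
rewrite (gder_gcomp0 F hf) //; last exact: gincl_gcomp.
by rewrite mul0w add0r mulr0 scale1r.
Qed.

(** Uniqueness of wheelcontractions reduces the claim to 1-forms, and C-linearity
on 1-forms reduces it to exact ones. *)
Lemma gder_neg_uniq {f g : fam F F 0} : is_gder (-1) f -> is_gder (-1) g ->
  (forall n (c : C n), f n (dgD W (gincl F c)) = g n (dgD W (gincl F c))) -> eqfam f g.
Proof.
move=> hf hg Efg; apply: (wc_inj E hf hg).
apply: (wmodmor_uniq W (N := gmod_module F) (gder_neg_mor hf) (gder_neg_mor hg)).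
by move=> n c; have := Efg n c; rewrite dgD_incl.
Qed.

Lemma contraction_gder {X} : iDer X -> is_gder (-1) (contraction E X).
Proof. by move=> hX; apply: wc_der; exact: to_hom_iHom. Qed.

Lemma contraction_incl {X} : iDer X ->
  forall n (c : C n), contraction E X (gincl F c) = 0.
Proof.
by move=> hX n c; rewrite (gder_gcomp0 F (contraction_gder hX)) //; exact: gincl_gcomp.
Qed.

Lemma contraction_exact {X} : iDer X ->
  forall n (c : C n), contraction E X (dgD W (gincl F c) : F n) = gincl F (X n c).
Proof.
move=> hX n c; rewrite dgD_incl /contraction /der_ext (wc_restr E (to_hom_iHom W hX)).
by rewrite (to_hom_d W hX).
Qed.

Lemma lieE X : lie E X = gbracket 1 (-1) (dgD W) (contraction E X).
Proof.
by apply/eqfam_eq => n u; rewrite /gbracket /lie mulrN1 expr1 scaleN1r opprK.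
Qed.

Lemma lie_gder {X} : iDer X -> is_gder 0 (lie E X).
Proof.
by move=> hX; rewrite lieE; exact: (gder_bracket F (dgD_der W) (contraction_gder hX)).
Qed.

Lemma dgD0 n : dgD W (0 : F n) = 0.
Proof. exact: (wmor0 (gder_wmor0 F (dgD_der W))). Qed.
Lemma dgDD n (u v : F n) : dgD W (u + v) = dgD W u + dgD W v.
Proof. exact: (wmorD (gder_wmor0 F (dgD_der W))). Qed.
Lemma dgDB n (u v : F n) : dgD W (u - v) = dgD W u - dgD W v.
Proof. exact: (wmorB (gder_wmor0 F (dgD_der W))). Qed.

Lemma lie_dgD X : iDer X -> forall n (u : F n), lie E X (dgD W u : F n) = dgD W (lie E X u : F n).
Proof.
move=> hX n u; rewrite /lie dgDD !dgD_sq add0r.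
by rewrite (wmor0 (gder_wmor0 F (contraction_gder hX))) addr0.
Qed.

Lemma lie_incl X : iDer X ->
  forall n (c : C n), lie E X (gincl F c) = gincl F (X n c).
Proof.
by move=> hX n c; rewrite /lie contraction_incl // dgD0 add0r contraction_exact.
Qed.

(** On a 1-form both terms apply a derivation of degree -1 to an element of
degree 0. *)
Lemma contraction_bracket X Y : iDer X -> iDer Y ->
  eqfam (gbracket (-1) (-1) (contraction E X) (contraction E Y)) (fun n u => 0).
Proof.
move=> hX hY.
have hi := gder_bracket F (contraction_gder hX) (contraction_gder hY).
apply: (gder_even_uniq W 2 _ _ isT isT hi (gder_zero F _)) => n x.
have V Z m (y : F m) : iDer Z -> gcomp 0 y -> contraction E Z y = 0.
  by move=> hZ; exact: (gder_gcomp0 F (contraction_gder hZ)).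
have [_ hx] := iota_mor1 W.
have Z0 Z : iDer Z -> gcomp 0 (contraction E Z (Defs.iota x) : F n).
  move=> hZ; apply/gcompZ_nat.
  by apply: (gder_gcompZ F (contraction_gder hZ) 1); exact/gcompZ_nat.
by rewrite /gbracket (V X _ _ hX (Z0 Y hY)) (V Y _ _ hY (Z0 X hX)) scaler0 subr0.
Qed.

Lemma lie_contraction X Y : iDer X -> iDer Y ->
  eqfam (gbracket 0 (-1) (lie E X) (contraction E Y)) (contraction E (der_bracket X Y)).
Proof.
move=> hX hY; have hXY := der_bracket_iDer hX hY.
apply: gder_neg_uniq.
- exact: (gder_bracket F (lie_gder hX) (contraction_gder hY)).
- exact: contraction_gder.
move=> n c; rewrite /gbracket mul0r expr0 scale1r lie_dgD //.
rewrite !(contraction_exact, lie_incl) // /der_bracket.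
have wi := wgmor_wmor (gincl_mor (gwP F)).
by rewrite (wmorB wi).
Qed.

(** Writing L_Y = D i_Y + i_Y D and moving D past L_X leaves
D [L_X, i_Y] + [L_X, i_Y] D. *)
Lemma lie_lie X Y : iDer X -> iDer Y ->
  eqfam (gbracket 0 0 (lie E X) (lie E Y)) (lie E (der_bracket X Y)).
Proof.
move=> hX hY n u; have B := lie_contraction _ _ hX hY.
have LD := wmorD (gder_wmor0 F (lie_gder hX)) n.
have LY (v : F n) : lie E Y v = dgD W (contraction E Y v : F n) + contraction E Y (dgD W v : F n) by [].
have R : lie E (der_bracket X Y) u =
  dgD W (contraction E (der_bracket X Y) u : F n) + contraction E (der_bracket X Y) (dgD W u : F n) by [].
rewrite R -!B /gbracket !mul0r expr0 !scale1r dgDB !LY LD !lie_dgD //.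
by rewrite opprD [LHS](AC (2*2) ((1*3)*(2*4))).
Qed.

End Cartan.

Theorem proposition4p45 (K : fieldType) (charK : [pchar K] =i pred0)
  (C : comWheelgebra K) (W : dgKahler C) (E : wheelcontractions W)
  (X Y : fam C (wreg C) 0) (derX : iDer X) (derY : iDer Y) :
  let D := dgD W in
  let i_ := contraction E in
  let L_ := lie E in
  [/\ eqfam (comp_endo D D) (fun n u => 0),
      eqfam (L_ X) (fun n u => comp_endo D (i_ X) u + comp_endo (i_ X) D u)
    & eqfam (gbracket 1 0 D (L_ X)) (fun n u => 0)] /\
  [/\ eqfam (gbracket (-1) (-1) (i_ X) (i_ Y)) (fun n u => 0),
      eqfam (gbracket 0 (-1) (L_ X) (i_ Y)) (i_ (der_bracket X Y))
    & eqfam (gbracket 0 0 (L_ X) (L_ Y)) (L_ (der_bracket X Y))].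
Proof.
move=> D i_ L_; split; split.
- by move=> n u; exact: dgD_sq.
- by [].
- move=> n u; rewrite /gbracket mulr0 expr0 scale1r.
  by apply/eqP; rewrite subr_eq0; apply/eqP/esym; exact: lie_dgD.
- exact: contraction_bracket.
- exact: lie_contraction.
- exact: lie_lie.
Qed.
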